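(* Let $a\in(0,1)$, $\theta\in\mathbb{R}$, $\mathbf{u}\in\mathbb{S}^2$ and $\kappa\ge 0$. Consider the time-homogeneous Markov chain $\left((X(t,\mathbf{x}))_{\mathbf{x}\in\mathbb{S}^2}\right)_{t\in\mathbb{Z}}$ with values in $\mathcal{C}_{\mathbb{S}^2}$ satisfying, for all $t\in\mathbb{Z}$ and $\mathbf{x}\in\mathbb{S}^2$, $$X(t,\mathbf{x})=\max\left\{aX(t-1,R_{\theta,\mathbf{u}}\mathbf{x}),\,(1-a)Z(t,\mathbf{x})\right\},$$ where $(Z(t,\mathbf{x}))_{\mathbf{x}\in\mathbb{S}^2}$, $t\in\mathbb{Z}$, are independent replications of the process $$Z(\mathbf{x})=\bigvee_{i=1}^{\infty}\left\{U_i f(\mathbf{x};\boldsymbol{\mu}_i,\kappa)\right\},\qquad\mathbf{x}\in\mathbb{S}^2,$$ and $(U_i,\boldsymbol{\mu}_i)_{i\ge 1}$ are the points of a Poisson point process on $(0,\infty)\times\mathbb{S}^2$ with intensity $u^{-2}\mathrm{d}u\times\lambda_{\mathbb{S}^2}(\mathrm{d}\boldsymbol{\mu})$. Let $\pi_\star$ be the unique invariant probability measure of this Markov chain, and let $\mathcal{P}^n$ denote its $n$-step transition operator. Let $\gamma\in(0,1)$ and, for $h\in\mathcal{C}_{\mathbb{S}^2}$, let $L(h)=\|h^\gamma\|_\infty$. Then there exist constants $C>0$ and $\rho\in(0,1)$ such that $$\left\|\mathcal{P}^n\varphi-\pi_\star(\varphi)\right\|_L\le C\rho^n\left\|\varphi-\pi_\star(\varphi)\right\|_L$$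 holds for every $n\in\mathbb{N}\setminus\{0\}$ and every measurable function $\varphi:\mathcal{C}_{\mathbb{S}^2}\to\mathbb{R}$ such that $\|\varphi\|_L<\infty$.
   Context: $\mathbb{S}^2=\{\mathbf{x}\in\mathbb{R}^3:\|\mathbf{x}\|=1\}$ is the Euclidean unit sphere and $\lambda_{\mathbb{S}^2}$ is the Lebesgue (surface) measure on it. $\mathcal{C}_{\mathbb{S}^2}=\mathcal{C}(\mathbb{S}^2,(0,\infty))$ is the space of continuous functions from $\mathbb{S}^2$ to $(0,\infty)$ with the topology induced by the uniform metric $d(h_1,h_2)=\|h_1-h_2\|_\infty$, where $\|h\|_\infty=\sup_{\mathbf{x}\in\mathbb{S}^2}|h(\mathbf{x})|$, and with its Borel $\sigma$-field $\mathcal{B}(\mathcal{C}_{\mathbb{S}^2})$. $f$ is the von Mises-Fisher density on $\mathbb{S}^2$ with mean direction $\boldsymbol{\mu}\in\mathbb{S}^2$ and concentration $\kappa\ge 0$: $$f(\mathbf{x};\boldsymbol{\mu},\kappa)=\frac{\kappa}{4\pi\sinh(\kappa)}\exp(\kappa\boldsymbol{\mu}'\mathbf{x}),\quad\mathbf{x}\in\mathbb{S}^2,$$ where $'$ denotes transposition; for $\kappa=0$ it is the uniform density $1/(4\pi)$. For $\theta\in\mathbb{R}$ and $\mathbf{u}=(u_x,u_y,u_z)'\in\mathbb{S}^2$, $R_{\theta,\mathbf{u}}=\cos\theta\, I_3+\sin\theta\,[\mathbf{u}]_\times+(1-\cos\theta)\,\mathbf{u}\mathbf{u}'$ is the rotation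 matrix of angle $\theta$ around the axis directed by $\mathbf{u}$, where $I_3$ is the identity matrix and $$[\mathbf{u}]_\times=\begin{pmatrix}0&-u_z&u_y\\ u_z&0&-u_x\\ -u_y&u_x&0\end{pmatrix}.$$ $\bigvee$ denotes the supremum over a countable set. The process $Z$ is almost surely positive and sample-continuous, so it is regarded as a random element of $\mathcal{C}_{\mathbb{S}^2}$. The transition kernel of the chain is $\mathcal{P}(h,B)=\mathbb{P}\left(\left(\max\{a\,h(R_{\theta,\mathbf{u}}\mathbf{x}),(1-a)Z(\mathbf{x})\}\right)_{\mathbf{x}\in\mathbb{S}^2}\in B\right)$ for $h\in\mathcal{C}_{\mathbb{S}^2}$ and $B\in\mathcal{B}(\mathcal{C}_{\mathbb{S}^2})$, and $\mathcal{P}^n(h,B)$ is the corresponding $n$-step transition probability. The chain has a unique invariant probability measure on $\mathcal{C}_{\mathbb{S}^2}$, denoted $\pi_\star$. For a measurable function $V:\mathcal{C}_{\mathbb{S}^2}\to\mathbb{R}$, $(\mathcal{P}^nV)(h)=\int_{\mathcal{C}_{\mathbb{S}^2}}V(y)\,\mathcal{P}^n(h,\mathrm{d}y)$. For a probability measure $\eta$ on $\mathcal{C}_{\mathbb{S}^2}$, $\eta(\varphi)=\int_{\mathcal{C}_{\mathbb{S}^2}}\varphi(y)\,\eta(\mathrm{d}y)$. For $L:\mathcal{C}_{\mathbb{S}^2}\to[0,\infty)$ and $\varphi:\mathcal{C}_{\mathbb{S}^2}\to\mathbb{R}$, the weighted supremum norm is $$\|\varphi\|_L=\sup_{h\in\mathcal{C}_{\mathbb{S}^2}}\frac{|\varphi(h)|}{1+L(h)}.$$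 The function $h^\gamma$ is the pointwise power $\mathbf{x}\mapsto h(\mathbf{x})^\gamma$, and the constant $\pi_\star(\varphi)$ is identified with the constant function on $\mathcal{C}_{\mathbb{S}^2}$. *)

(* Defs.v *)
From HB Require Import structures.
From mathcomp Require Import all_boot all_order all_algebra.
From mathcomp Require Import all_classical all_reals all_analysis.
From mathcomp Require Import measurable_realfun.
From mathcomp Require Import ring lra.

Set Implicit Arguments.
Unset Strict Implicit.
Unset Printing Implicit Defensive.

Import Order.TTheory GRing.Theory Num.Theory.
Import numFieldNormedType.Exports.

Local Open Scope classical_set_scope.
Local Open Scope ring_scope.

Section sphere.
Context {R : realType}.

Definition dot3 (x y : 'cV[R]_3) : R := (x^T *m y) 0 0.

(* The norm on matrices of the library is the max norm, so the Euclidean unit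
   sphere is expressed through the scalar product. *)
Definition sphere : set 'cV[R]_3 := [set x | dot3 x x = 1].

Lemma dot3E (x y : 'cV[R]_3) :
  dot3 x y = x 0 0 * y 0 0 + x 1 0 * y 1 0 + x 2 0 * y 2 0.
Proof.
rewrite /dot3 mxE !big_ord_recl big_ord0 !mxE addr0 addrA.
by congr (_ * _ + _ * _ + _ * _); congr (_ _ _); exact/val_inj.
Qed.

End sphere.
Arguments sphere : clear implicits.

Definition S2 (R : realType) : Type := set_type (sphere R).

HB.instance Definition _ (R : realType) :=
  Topological.copy (S2 R) (set_type (sphere R)).

Definition vec {R : realType} (x : S2 R) : 'cV[R]_3 := set_val x.

Section sphere_instances.
Context {R : realType}.

Lemma vecP (x : S2 R) : dot3 (vec x) (vec x) = 1.
Proof. exact: (set_valP x). Qed.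

Lemma vec_inj : injective (@vec R).
Proof. exact: val_inj. Qed.

Lemma vec_continuous : continuous (@vec R).
Proof. exact: initial_continuous. Qed.

Lemma sphere_north : dot3 (delta_mx 2 0 : 'cV[R]_3) (delta_mx 2 0) = 1.
Proof. by rewrite dot3E !mxE /=; ring. Qed.

Definition mkS2 (x : 'cV[R]_3) (hx : dot3 x x = 1) : S2 R := SigSub (mem_set hx).

Lemma vec_mkS2 x hx : vec (@mkS2 x hx) = x.
Proof. by []. Qed.

HB.instance Definition _ := isPointed.Build (S2 R) (mkS2 sphere_north).

HB.instance Definition _ := @isMeasurable.Build (sigma_display (@open (S2 R)))
  (S2 R) <<s @open (S2 R) >> (@sigma_algebra0 _ setT (@open (S2 R)))
  (@sigma_algebraC _ (@open (S2 R))) (@sigma_algebra_bigcup _ setT _).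

End sphere_instances.

Section rotation.
Context {R : realType}.

Definition crossmx (u : 'cV[R]_3) : 'M[R]_3 :=
  \matrix_(i, j) (nth [::] [:: [:: 0; - u 2 0; u 1 0];
                               [:: u 2 0; 0; - u 0 0];
                               [:: - u 1 0; u 0 0; 0]] i)`_j.

Definition rotmx (theta : R) (u : 'cV[R]_3) : 'M[R]_3 :=
  cos theta *: 1%:M + sin theta *: crossmx u + (1 - cos theta) *: (u *m u^T).

Lemma rotmx_sphere theta (u x : 'cV[R]_3) :
  dot3 u u = 1 -> dot3 x x = 1 ->
  dot3 (rotmx theta u *m x) (rotmx theta u *m x) = 1.
Proof.
move=> hu hx; have := cos2Dsin2 theta.
move: hu hx; rewrite !dot3E.
have E (i : 'I_3) : (rotmx theta u *m x) i 0 =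
   rotmx theta u i 0 * x 0 0 + rotmx theta u i 1 * x 1 0 + rotmx theta u i 2 * x 2 0.
  rewrite mxE !big_ord_recl big_ord0 addr0 addrA.
  by congr (_ * _ + _ * _ + _ * _); congr (_ _ _); exact/val_inj.
rewrite !E /rotmx !mxE !big_ord1 !mxE /=.
set a := u 0 0; set b := u 1 0; set c := u 2 0.
set p := x 0 0; set q := x 1 0; set r := x 2 0.
set C := cos theta; set S := sin theta.
move=> hu hx hCS.
transitivity (C ^+ 2 * (p * p + q * q + r * r)
  + S ^+ 2 * ((a * a + b * b + c * c) * (p * p + q * q + r * r) - (a * p + b * q + c * r) ^+ 2)
  + (1 - C) ^+ 2 * (a * p + b * q + c * r) ^+ 2 * (a * a + b * b + c * c)
  + 2 * C * (1 - C) * (a * p + b * q + c * r) ^+ 2); first by ring.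
rewrite hu hx (_ : S ^+ 2 = 1 - C ^+ 2); last by rewrite -hCS; ring.
ring.
Qed.

Definition rot (theta : R) (u x : S2 R) : S2 R :=
  mkS2 (rotmx_sphere theta (vecP u) (vecP x)).

End rotation.

Section compactness.
Context {R : realType}.

Lemma trmx_rV3_continuous : continuous (fun v : 'rV[R]_3 => v^T : 'cV[R]_3).
Proof.
move=> v P [Q nQ QP]; exists (fun i j => Q j i) => [i j|w hw].
  by have := nQ j i; rewrite mxE.
by apply: QP => i j; rewrite mxE.
Qed.

Definition rsphere : set 'rV[R]_3 := [set v | dot3 v^T v^T = 1].

Lemma rsphere_compact : compact rsphere.
Proof.
apply: bounded_closed_compact.
  exists 1; split => // M M1 v; rewrite /rsphere/= dot3E !mxE => hv.
  rewrite /Num.norm/= mx_normrE; apply: (le_trans _ (ltW M1)).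
  apply: bigmax_le => // -[i j] _ /=; rewrite (ord1 i).
  rewrite -(ler_pXn2r (n := 2)) ?nnegrE// expr1n real_normK ?num_real//.
  have : [\/ j = 0, j = 1 | j = 2].
    by case: j => -[|[|[|//]]] ?; [apply: Or31|apply: Or32|apply: Or33];
      exact/val_inj.
  by case=> ->; nra.
rewrite (_ : rsphere = (fun v : 'rV[R]_3 =>
    v 0 0 * v 0 0 + v 0 1 * v 0 1 + v 0 2 * v 0 2) @^-1` [set 1]).
  apply: preimage_closed; last exact: (@closed_eq R 1).
  move=> v _.
  have h i j : {for v, continuous (fun v : 'rV[R]_3 => v i j : R)}.
    exact: coord_continuous.
  exact: (continuousD (continuousD (continuousM (h 0 0) (h 0 0))
    (continuousM (h 0 1) (h 0 1))) (continuousM (h 0 2) (h 0 2))).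
by apply/seteqP; split => v; rewrite /rsphere/= dot3E !mxE.
Qed.

Lemma compact_sphere : compact (sphere R).
Proof.
rewrite (_ : sphere R = trmx @` rsphere).
  apply: continuous_compact rsphere_compact.
  exact: (continuous_subspaceT trmx_rV3_continuous).
apply/seteqP; split => [x hx|_ [v hv <-]//].
by exists x^T => /=; rewrite /rsphere/= ?trmxK.
Qed.

Lemma S2_compact : compact [set: S2 R].
Proof.
move=> F FF _.
have [|p [sp cp]] := @compact_sphere (@vec R @ F) _.
  suff : F (@vec R @^-1` sphere R) by [].
  by apply: filterS filterT => x _; exact: vecP.
exists (mkS2 sp); split => // A B FA [_ [[B' oB' <-] Bp] sB].
have [|_ [[x Ax <-] Bx]] := cp (@vec R @` A) B' _ (open_nbhs_nbhs (conj oB' Bp)).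
  suff : F (@vec R @^-1` (@vec R @` A)) by [].
  by apply: filterS FA => x Ax; exists x.
by exists x; split => //; exact: sB.
Qed.

Lemma S2_continuous_bounded (f : S2 R -> R) : continuous f ->
  exists M, forall x, `|f x| <= M.
Proof.
move=> cf.
have : compact (f @` setT).
  by apply: continuous_compact S2_compact; exact: continuous_subspaceT.
move=> /compact_bounded[M [_ hM]]; exists (M + 1) => x.
by apply: (hM (M + 1)); [rewrite ltrDl|exists x].
Qed.

End compactness.

Section function_space.
Context {R : realType}.

Definition supnorm (f : S2 R -> R) : R := sup [set `|f x| | x in setT].

Lemma supnorm_ub f x : continuous f -> `|f x| <= supnorm f.
Proof.
move=> /S2_continuous_bounded[M fM]; apply: ub_le_sup; last by exists x.
by exists M => _ [y _ <-].
Qed.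

Lemma supnorm_le f M : (forall x, `|f x| <= M) -> supnorm f <= M.
Proof.
by move=> fM; apply: ge_sup => [|_ [y _ <-]//]; exists (`|f point|), point.
Qed.

Record CS2 := MkCS2 {
  CS2_fun :> S2 R -> R;
  CS2_continuous : continuous CS2_fun;
  CS2_gt0 : forall x, 0 < CS2_fun x }.

Lemma CS2_ext (g h : CS2) : g =1 h -> g = h.
Proof.
case: g h => [g gc g0] [h hc h0] /= /funext gh; rewrite -gh in hc h0 *.
by congr MkCS2; exact: Prop_irrelevance.
Qed.

HB.instance Definition _ := gen_eqMixin CS2.
HB.instance Definition _ := gen_choiceMixin CS2.

Lemma cst1_gt0 (x : S2 R) : 0 < (cst 1 x : R). Proof. exact: ltr01. Qed.

HB.instance Definition _ :=
  isPointed.Build CS2 (MkCS2 (@cst_continuous (S2 R) R 1) cst1_gt0).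

Definition CS2_dist (g h : CS2) : R := supnorm (fun x => g x - h x).

Lemma CS2_sub_continuous (g h : CS2) : continuous (fun x => g x - h x).
Proof.
move=> x; apply: (@continuousB _ R^o _ g h x); exact: CS2_continuous.
Qed.

Lemma CS2_dist_ub (g h : CS2) x : `|g x - h x| <= CS2_dist g h.
Proof. exact: (supnorm_ub x (@CS2_sub_continuous g h)). Qed.

Lemma CS2_distxx g : CS2_dist g g = 0.
Proof.
apply/eqP; rewrite eq_le; apply/andP; split.
  by apply: supnorm_le => x; rewrite subrr normr0.
by apply: le_trans (CS2_dist_ub g g point); exact: normr_ge0.
Qed.

Lemma CS2_dist_eq0 g h : CS2_dist g h = 0 -> g = h.
Proof.
move=> gh; apply: CS2_ext => x; apply/eqP; rewrite -subr_eq0 -normr_le0 -gh.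
exact: CS2_dist_ub.
Qed.

Lemma CS2_dist_sym g h : CS2_dist g h = CS2_dist h g.
Proof.
by rewrite /CS2_dist /supnorm; congr sup; apply/seteqP; split => _ [x _ <-];
  exists x => //; exact: distrC.
Qed.

Lemma CS2_dist_triangle h g k :
  CS2_dist g k <= CS2_dist g h + CS2_dist h k.
Proof.
apply: supnorm_le => x; apply: (le_trans (ler_distD (h x) _ _)).
by apply: lerD; exact: CS2_dist_ub.
Qed.

HB.instance Definition _ := isMetric.Build R CS2
  CS2_distxx CS2_dist_eq0 CS2_dist_sym CS2_dist_triangle.

HB.instance Definition _ := @isMeasurable.Build (sigma_display (@open CS2))
  CS2 <<s @open CS2 >> (@sigma_algebra0 _ setT (@open CS2))
  (@sigma_algebraC _ (@open CS2)) (@sigma_algebra_bigcup _ setT _).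

End function_space.
Arguments CS2 : clear implicits.

Section max_step.
Context {R : realType}.

Lemma mulmx_cV3_continuous (A : 'M[R]_3) : continuous (fun v : 'cV[R]_3 => A *m v).
Proof.
move=> v P [Q nQ QP].
suff nearQ : \forall w \near v, forall ij : 'I_3 * 'I_1, Q ij.1 ij.2 ((A *m w) ij.1 ij.2).
  by apply: filterS nearQ => w hw; apply: QP => i j; exact: (hw (i, j)).
apply: (@filter_forall _ _ (fun (ij : 'I_3 * 'I_1) (w : 'cV[R]_3) =>
  Q ij.1 ij.2 ((A *m w) ij.1 ij.2)) (nbhs v) (nbhs_filter v)) => -[i j] /=.
have h k : {for v, continuous (fun v : 'cV[R]_3 => A i k * v k j : R)}.
  apply: (@continuousM _ _ (cst (A i k)) (fun v : 'cV[R]_3 => v k j : R)).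
    exact: cst_continuous.
  exact: coord_continuous.
suff c : {for v, continuous (fun w : 'cV[R]_3 => (A *m w) i j : R)}.
  by have := c _ (nQ i j).
rewrite (_ : (fun w => _) = ((fun v : 'cV[R]_3 => A i 0 * v 0 j : R)
    \+ (fun v => A i 1 * v 1 j) \+ (fun v => A i 2 * v 2 j))).
  exact: (continuousD (continuousD (h 0) (h 1)) (h 2)).
apply/funext => w; rewrite mxE !big_ord_recl big_ord0 addr0 addrA /=.
by congr (_ * _ + _ * _ + _ * _); congr (_ _ _); exact/val_inj.
Qed.

Lemma rot_continuous theta (u : S2 R) : continuous (rot theta u).
Proof.
apply: (@continuous_comp_initial _ _ _ (@vec R)) => x.
apply: (@continuous_comp _ _ _ (@vec R) (mulmx (rotmx theta (vec u))) x).
  exact: vec_continuous.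
exact: mulmx_cV3_continuous.
Qed.

Variables (a theta : R) (u : S2 R).

Definition max_step_fun (h z : CS2 R) (x : S2 R) : R :=
  Num.max (a * h (rot theta u x)) ((1 - a) * z x).

Lemma max_step_continuous h z : continuous (max_step_fun h z).
Proof.
move=> x; apply: (@continuous_max R _
  (fun x => a * h (rot theta u x)) (fun x => (1 - a) * z x)).
  apply: (@continuousM _ _ (cst a) (h \o rot theta u)).
    exact: cst_continuous.
  apply: continuous_comp; first exact: rot_continuous.
  exact: CS2_continuous.
apply: (@continuousM _ _ (cst (1 - a)) z); first exact: cst_continuous.
exact: CS2_continuous.
Qed.

Lemma max_step_gt0 h z x : 0 < max_step_fun h z x.
Proof.
rewrite lt_max; have [a0|a0] := ltP 0 a.
  by rewrite mulr_gt0// CS2_gt0.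
by rewrite orbC mulr_gt0 ?CS2_gt0// subr_gt0 (le_lt_trans a0).
Qed.

(* Positivity needs no condition on a: one of a and 1 - a is positive. *)
Definition max_step (h z : CS2 R) : CS2 R :=
  MkCS2 (@max_step_continuous h z) (max_step_gt0 h z).

Lemma max_stepE h z x :
  max_step h z x = Num.max (a * h (rot theta u x)) ((1 - a) * z x).
Proof. by []. Qed.

Lemma distr_max (p q r s : R) :
  `|Num.max p q - Num.max r s| <= Num.max `|p - r| `|q - s|.
Proof.
have := ler_norm (p - r); have := ler_norm (r - p); rewrite (distrC r).
have := ler_norm (q - s); have := ler_norm (s - q); rewrite (distrC s).
move=> ? ? ? ?; rewrite le_max; case: (leP p q) => pq; case: (leP r s) => rs;
  rewrite ?lexx ?orbT// !ler_norml.
  by have [qr|qr] := leP r q; [apply/orP; right|apply/orP; left]; lra.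
by have [ps|ps] := leP p s; [apply/orP; right|apply/orP; left]; lra.
Qed.

Lemma max_step_dist (h h' z z' : CS2 R) :
  mdist (max_step h z) (max_step h' z') <=
  Num.max (`|a| * mdist h h') (`|1 - a| * mdist z z').
Proof.
apply: supnorm_le => x; rewrite !max_stepE.
apply: (le_trans (distr_max _ _ _ _)); rewrite -!mulrBr !normrM.
rewrite ge_max !le_max; apply/andP; split; apply/orP; [left|right];
  by rewrite ler_wpM2l// CS2_dist_ub.
Qed.

End max_step.

Section transition_kernel.
Context {R : realType} d (Omega : measurableType d).
Variables (P : probability Omega R) (a theta : R) (u : S2 R).

Lemma CS2_open_measurable (A : set (CS2 R)) : open A -> measurable A.
Proof. exact: sub_sigma_algebra. Qed.

Lemma CS2_openP (A : set (CS2 R)) :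
  open A <-> forall y, A y -> exists2 e, 0 < e & ball y e `<=` A.
Proof.
rewrite openE; split => oA y /oA; first by move=> /nbhs_ballP[e]; exists e.
by move=> [e e0 eA]; apply/nbhs_ballP; exists e.
Qed.

Lemma max_step_measurable (h : CS2 R) :
  measurable_fun setT (max_step a theta u h).
Proof.
apply: (@measurability _ _ _ _ _ _ (@open (CS2 R))) => //.
move=> _ [B oB <-]; rewrite setTI; apply: CS2_open_measurable.
apply/CS2_openP => z /= Bz; have [e e0 eB] := (CS2_openP B).1 oB _ Bz.
exists (e / (`|1 - a| + 1)) => /=.
  by rewrite divr_gt0// ltr_wpDl.
move=> z'; rewrite ballEmdist /= => zz'; apply: eB; rewrite ballEmdist /=.
apply: (le_lt_trans (max_step_dist _ _ _ _ _ _ _)).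
rewrite mdistxx mulr0 gt_max e0/=.
rewrite ltr_pdivlMr ?ltr_wpDl// in zz'.
apply: le_lt_trans zz'; rewrite mulrC ler_wpM2l ?mdist_ge0// lerDl//.
Qed.

HB.instance Definition _ (h : CS2 R) :=
  isMeasurableFun.Build _ _ _ _ (max_step a theta u h) (max_step_measurable h).

Variable Z : {RV P >-> CS2 R}.

Definition trans_kernel (h : CS2 R) : {measure set CS2 R -> \bar R} :=
  distribution P (max_step a theta u h \o Z).

Lemma trans_kernelE h B :
  trans_kernel h B = P [set w | B (max_step a theta u h (Z w))].
Proof. by []. Qed.

Lemma trans_kernel_lsc (O : set (CS2 R)) (c : \bar R) : open O ->
  open [set h | (c < trans_kernel h O)%E].
Proof.
move=> oO; pose r (n : nat) : R := n.+1%:R^-1.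
pose F n := [set y : CS2 R | ball y (r n) `<=` O].
have mF n : measurable (F n).
  rewrite -[F n]setCK; apply: measurableC; apply: CS2_open_measurable.
  apply/CS2_openP => y /existsNP[z /not_implyP[]].
  rewrite ballEmdist /= => yz Oz; exists (r n - mdist y z) => /=; first by rewrite subr_gt0.
  move=> y'; rewrite ballEmdist /= => yy' Fy'; apply: Oz; apply: Fy'.
  rewrite ballEmdist /= (le_lt_trans (metric_triangle _ y _))//.
  by rewrite metric_sym; move: yy'; lra.
have FO : \bigcup_n F n = O.
  apply/seteqP; split => [y [n _ Fy]|y Oy].
    by apply: Fy; apply: ballxx; rewrite invr_gt0.
  have [e e0 eO] := (CS2_openP O).1 oO y Oy.
  exists (Num.truncn e^-1) => // z; rewrite ballEmdist /= => yz; apply: eO.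
  rewrite ballEmdist /= (lt_trans yz)// /r invf_plt ?posrE//.
  by rewrite truncnS_gt// num_real.
have ndF : nondecreasing_seq F.
  move=> m n mn; apply/subsetPset => y Fy z yz; apply: Fy; move: z yz.
  by apply: le_ball; rewrite /r lef_pV2 ?posrE// ler_nat.
apply/CS2_openP => h /= ch.
have cF : trans_kernel h \o F @ \oo --> trans_kernel h O.
  rewrite -FO; apply: nondecreasing_cvg_mu => //.
  by apply: bigcup_measurable => k _.
have [n cFn] : exists n, (c < trans_kernel h (F n))%E.
  apply/not_existsP => hn; move: ch; apply/negP; rewrite -leNgt.
  rewrite -(cvg_lim _ cF)//; apply: lime_le.
    by apply/cvg_ex; exists (trans_kernel h O).
  by apply: nearW => n /=; rewrite leNgt; apply/negP/hn.
exists (r n / (`|a| + 1)).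
  by rewrite divr_gt0// ?invr_gt0// ltr_wpDl.
move=> h'; rewrite ballEmdist /= => hh'; apply: (lt_le_trans cFn).
rewrite !trans_kernelE; apply: le_measure; rewrite ?inE.
- exact: (measurable_funPTI (max_step a theta u h \o Z) (mF n)).
- exact: (measurable_funPTI (max_step a theta u h' \o Z) (CS2_open_measurable oO)).
move=> w /= Fw; apply: Fw; rewrite ballEmdist /=.
apply: (le_lt_trans (max_step_dist _ _ _ _ _ _ _)).
rewrite mdistxx mulr0 gt_max invr_gt0 ltr0n /= andbT.
rewrite ltr_pdivlMr ?ltr_wpDl// in hh'.
apply: le_lt_trans hh'; rewrite mulrC ler_wpM2l ?mdist_ge0// lerDl//.
Qed.

Lemma trans_kernel_measurable B : measurable B ->
  measurable_fun [set: CS2 R] (fun h => trans_kernel h B : \bar R).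
Proof.
move: B; apply: (@dynkin_induction _ _ (@open (CS2 R)) (fun B =>
  measurable_fun [set: CS2 R] (fun h => trans_kernel h B : \bar R))).
- by [].
- by move=> A B; exact: openI.
- rewrite (_ : (fun _ => _) = cst 1%E)//.
  by apply/funext => h; rewrite /trans_kernel /= probability_setT.
- move=> B oB; apply: (measurability _ (ErealGenOInfty.measurableE R)).
  move=> /= _ [_ [c ->]] <-; rewrite setTI preimage_itvoy.
  by apply: CS2_open_measurable; exact: trans_kernel_lsc.
- move=> B mB mKB; rewrite (_ : (fun _ => _) =
    (fun h => 1 - trans_kernel h B)%E); last first.
    by apply/funext => h; rewrite /trans_kernel /= probability_setC.
  by apply: emeasurable_funB => //; exact: measurable_cst.
- move=> F mF tF mKF; rewrite (_ : (fun _ => _) =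
    (fun h => \sum_(k <oo | k \in [set: nat]) trans_kernel h (F k))%E); last first.
    by apply/funext => h; rewrite measure_bigcup.
  by apply: ge0_emeasurable_sum.
Qed.

HB.instance Definition _ :=
  isKernel.Build _ _ _ _ R trans_kernel trans_kernel_measurable.

Lemma trans_kernel_setT h : trans_kernel h [set: CS2 R] = 1%E.
Proof. by rewrite /trans_kernel /= probability_setT. Qed.

HB.instance Definition _ :=
  Kernel_isProbability.Build _ _ _ _ R trans_kernel trans_kernel_setT.

End transition_kernel.

Section markov_kernel.
Context {R : realType} d (X : measurableType d).

(* k_0 h = \d_h and k_(n+1) (h, B) = \int k(h, dy) k_n (y, B) *)
Fixpoint nstep (k : R.-pker X ~> X) (n : nat) : R.-spker X ~> X :=
  if n is m.+1 then mkcomp_noparam k (nstep k m)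
  else kdirac (@measurable_id _ X setT).

Definition kernel_op (k : X -> {measure set X -> \bar R}) (V : X -> R) : X -> R :=
  fun h => \int[k h]_y V y.

Definition invariant_measure (k : R.-pker X ~> X) (p : probability X R) : Prop :=
  forall B, measurable B -> (\int[p]_h k h B)%E = p B.

(* Two measures may differ as functions on non-measurable sets, hence the
   comparison on measurable sets only. *)
Definition unique_invariant_measure (k : R.-pker X ~> X) (p : probability X R) : Prop :=
  invariant_measure k p /\
  forall q : probability X R, invariant_measure k q ->
    forall B, measurable B -> q B = p B.

Definition wsupnorm (L phi : X -> R) : \bar R :=
  ereal_sup [set (`|phi h| / (1 + L h))%:E | h in [set: X]].

End markov_kernel.

Section poisson_point_process.
Context {R : realType} d d' (Omega : measurableType d) (E : measurableType d').
Variable P : probability Omega R.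

Definition npoints (xi : nat -> Omega -> E) (B : set E) (w : Omega) : \bar R :=
  counting [set i | B (xi i w)].

(* poisson_prob r is used rather than poisson_pmf r because the latter is not
   the Dirac mass at 0 for r = 0. *)
Definition poisson_point_process (nu : set E -> \bar R)
    (xi : nat -> Omega -> E) : Prop :=
  [/\ forall i, measurable_fun setT (xi i),
      forall B, measurable B -> nu B \is a fin_num -> forall k : nat,
        P [set w | npoints xi B w = k%:R%:E] =
        poisson_prob (fine (nu B)) k [set k],
      forall B, measurable B -> nu B = +oo%E ->
        P [set w | npoints xi B w = +oo%E] = 1%E &
      forall (n : nat) (B : 'I_n -> set E) (k : 'I_n -> \bar R),
        (forall j, measurable (B j)) -> trivIset setT B ->
        P [set w | forall j, npoints xi (B j) w = k j] =
        (\prod_(j < n) P [set w | npoints xi (B j) w = k j])%E].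

End poisson_point_process.

Section von_mises_fisher_process.
Context {R : realType}.
Local Notation leb := (@lebesgue_measure R).

Lemma spherical_sphere (phi psi : R) :
  let v : 'cV[R]_3 := \col_i
    [:: sin phi * cos psi; sin phi * sin psi; cos phi]`_i in
  dot3 v v = 1.
Proof.
rewrite /= dot3E !mxE /=; have := cos2Dsin2 phi; have := cos2Dsin2 psi.
set C := cos phi; set S := sin phi; set c := cos psi; set s := sin psi.
move=> h1 h2; transitivity (S ^+ 2 * (c ^+ 2 + s ^+ 2) + C ^+ 2); first by ring.
by rewrite h1 mulr1 addrC.
Qed.

(* colatitude phi, longitude psi *)
Definition spherical (phi psi : R) : S2 R := mkS2 (spherical_sphere phi psi).

(* The area element of the sphere in spherical coordinates is
   sin phi dphi dpsi. *)
Definition surface_measure (A : set (S2 R)) : \bar R :=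
  (\int[leb]_(phi in `[0%R, pi]) \int[leb]_(psi in `[0%R, (2 * pi)%R])
    (sin phi * \1_A (spherical phi psi))%:E)%E.

(* u^-2 du x surface_measure, as a set function on R x S2 carried by
   ]0, +oo[ x S2 *)
Definition intensity (B : set (R * S2 R)) : \bar R :=
  (\int[leb]_(v in `]0%R, +oo[) ((v ^- 2)%:E * surface_measure (xsection B v)))%E.

Definition sinh (x : R) : R := (expR x - expR (- x)) / 2.

Definition vmf (kappa : R) (mu x : S2 R) : R :=
  if kappa == 0 then (4 * pi)^-1
  else kappa / (4 * pi * sinh kappa) * expR (kappa * dot3 (vec mu) (vec x)).

(* Z is, almost surely, the pointwise supremum of the U_i f(.; mu_i, kappa) *)
Definition vmf_process d (Omega : measurableType d) (P : probability Omega R)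
    (kappa : R) (U : nat -> Omega -> R) (mu : nat -> Omega -> S2 R)
    (Z : Omega -> CS2 R) : Prop :=
  [/\ forall i w, 0 < U i w,
      poisson_point_process P intensity (fun i w => (U i w, mu i w)) &
      {ae P, forall w, forall x, (Z w x)%:E =
        ereal_sup [set (U i w * vmf kappa (mu i w) x)%:E | i in [set: nat]]}].

End von_mises_fisher_process.

(* Main.v *)
Require Import Defs.
From mathcomp Require Import all_boot all_order all_algebra.
From mathcomp Require Import all_classical all_reals all_analysis.
From mathcomp Require Import measurable_realfun.
From mathcomp Require Import ring lra.

Set Implicit Arguments.
Unset Strict Implicit.
Unset Printing Implicit Defensive.

Import Order.TTheory GRing.Theory Num.Theory.
Import numFieldNormedType.Exports.

Local Open Scope classical_set_scope.
Local Open Scope ring_scope.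

(** The chain is an iterated random map, X_(t+1) = max_step X_t Z_(t+1), and the
    argument is the Hairer-Mattingly form of Harris' theorem with the
    synchronous coupling (both copies use the same Z).  Drift: with
    L h = ||h^gamma||, one step gives
    L (max_step h z) <= a^gamma L h + (1 - a)^gamma L z, and E L(Z) is finite
    because ||Z|| is at most a multiple of the largest U_i, whose tail
    1 - exp (- 4 pi / t) is at most 4 pi / t, while gamma < 1.  Coalescence: two
    copies agree after one step as soon as inf Z is large compared with both
    norms, which has positive probability because inf Z is at least a positive
    multiple of the largest U_i.  Hence for some beta > 0 one step contracts
    the weighted distance 2 + beta (L h + L h') (0 if h = h') in expectation;
    iterating and integrating h' against the invariant measure gives the
    bound. *)

(** * Harris' theorem for iterated random maps *)

Section mixture.
Context {R : realType} d d1 d2 (X : measurableType d) (Y : measurableType d1)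
  (Z : measurableType d2).
Variables (l : R.-spker X ~> Y) (k : R.-spker Y ~> Z) (x : X)
  (m : {measure set Z -> \bar R}).
Hypothesis mE : forall B, measurable B -> m B = (\int[l x]_y k y B)%E.

Lemma ge0_integral_mixture (f : Z -> \bar R) :
  measurable_fun [set: Z] f -> (forall z, 0 <= f z)%E ->
  (\int[m]_z f z = \int[l x]_y \int[k y]_z f z)%E.
Proof.
move=> mf f0.
(* Composition expects a kernel on the product space; [kernel_snd] lets [k] ignore the first
   coordinate. *)
rewrite (eq_measure_integral (kcomp l (kernel.kernel_snd k) x)).
  by rewrite integral_kcomp.
by move=> A mA _; rewrite mE.
Qed.

Lemma Rintegral_kernel_measurable (f : Z -> R) : measurable_fun setT f ->
  measurable_fun setT (fun y => \int[k y]_z f z).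
Proof.
move=> mf; apply: (measurableT_comp (f := @fine R)) => //.
rewrite (_ : (fun _ => _) = (fun y =>
  \int[k y]_z (EFin \o f)^\+ z - \int[k y]_z (EFin \o f)^\- z)%E); last first.
  by apply/funext => y; rewrite integralE.
have mk U : measurable U -> measurable_fun setT (k ^~ U).
  exact: measurable_kernel.
apply: emeasurable_funB; apply: measurable_fun_integral_kernel => //.
  exact/measurable_funepos/measurable_EFinP.
exact/measurable_funeneg/measurable_EFinP.
Qed.

(** Integrability against [m] makes the iterated integrals of both parts of [f] finite, so they may
    be subtracted under [l x]; integrability against each [k y] ensures that [fine] loses nothing
    inside. *)
Lemma Rintegral_mixture (f : Z -> R) :
  m.-integrable setT (EFin \o f) ->
  (forall y, (k y).-integrable setT (EFin \o f)) ->
  \int[m]_z f z = \int[l x]_y \int[k y]_z f z.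
Proof.
move=> imf ikf; have mf := measurable_int _ imf.
have mk U : measurable U -> measurable_fun setT (k ^~ U).
  exact: measurable_kernel.
have mp := measurable_funepos mf; have mn := measurable_funeneg mf.
have fpy := integral_funepos_lt_pinfty measurableT imf.
have fny := integral_funeneg_lt_pinfty measurableT imf.
rewrite (ge0_integral_mixture mp)// in fpy.
rewrite (ge0_integral_mixture mn)// in fny.
rewrite /Rintegral integralE (ge0_integral_mixture mp)// (ge0_integral_mixture mn)//.
congr fine.
transitivity (\int[l x]_y (\int[k y]_z (EFin \o f)^\+ z
    - \int[k y]_z (EFin \o f)^\- z))%E; last first.
  apply: eq_integral => y _; rewrite fineK.
    by rewrite [RHS]integralE.
  exact: integrable_fin_num.
apply/esym/integralB => //.
- apply/integrableP; split; first exact: measurable_fun_integral_kernel.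
  by under eq_integral do rewrite gee0_abs ?integral_ge0//.
- apply/integrableP; split; first exact: measurable_fun_integral_kernel.
  by under eq_integral do rewrite gee0_abs ?integral_ge0//.
Qed.

End mixture.

(** The ball of radius [N] in the weighted supremum norm, with a real radius so that the estimates
    stay in [R]. *)
Definition weight_bounded {R : realType} d (X : measurableType d) (L : X -> R)
    (N : R) (f : X -> R) : Prop :=
  measurable_fun setT f /\ forall h, `|f h| <= N * (1 + L h).

(** * Integrability and iteration under the drift condition *)

Section iterated_random_map.
Context {R : realType} d d' (Omega : measurableType d) (X : measurableType d').
Variables (P : probability Omega R) (k : R.-pker X ~> X)
  (F : X -> {RV P >-> X}) (L : X -> R) (ell : Omega -> R) (b : R).
Hypothesis kE : forall h B, measurable B -> k h B = distribution P (F h) B.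
Hypothesis L_meas : measurable_fun [set: X] L.
Hypothesis L_ge0 : forall h, 0 <= L h.
Hypothesis ell_ge0 : forall w, 0 <= ell w.
Hypothesis ell_int : P.-integrable setT (EFin \o ell).
Hypothesis b_ge0 : 0 <= b.
Hypothesis b_lt1 : b < 1.
Hypothesis drift : forall h w, L (F h w) <= b * L h + ell w.

Local Notation K := (\int[P]_w ell w).

Let K_ge0 : 0 <= K.
Proof. exact: Rintegral_ge0. Qed.

Let cst_int c : P.-integrable setT (EFin \o cst c).
Proof. exact: finite_measure_integrable_cst. Qed.

Let affine_int p q : P.-integrable setT (EFin \o (fun w => p + q * ell w)).
Proof.
rewrite (_ : _ \o _ = (EFin \o cst p) \+ (fun w => q%:E * (EFin \o ell) w))%E.
  by apply: integrableD => //; exact: integrableZl.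
by apply/funext => w; rewrite /= EFinD EFinM.
Qed.

Let Rintegral_affine p q : \int[P]_w (p + q * ell w) = p + q * K.
Proof.
have i2 : P.-integrable setT (EFin \o (fun w => q * ell w)).
  rewrite (_ : _ \o _ = (fun w => q%:E * (EFin \o ell) w))%E.
    exact: integrableZl.
  by apply/funext => w; rewrite /= EFinM.
rewrite (RintegralD measurableT (cst_int p) i2) Rintegral_cst// RintegralZl//.
by rewrite [X in fine X]probability_setT mulr1.
Qed.

Local Notation wbound := (weight_bounded L).

Lemma weight_bounded_ge0 N f : wbound N f -> 0 <= N.
Proof.
move=> [_ /(_ point)] /(le_trans (normr_ge0 _)).
by rewrite pmulr_lge0// ltr_pwDl.
Qed.

(** The drift bound dominates [f \o F h] by an affine function of [ell]. *)
Lemma weight_bounded_map N f h : wbound N f ->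
  P.-integrable setT (EFin \o (f \o F h)).
Proof.
move=> fN; have N0 := weight_bounded_ge0 fN; case: fN => mf fN.
apply: (le_integrable measurableT _ _ (affine_int (N * (1 + b * L h)) N)).
  by apply/measurable_EFinP; exact: measurableT_comp.
move=> w _ /=; rewrite lee_fin (le_trans (fN _))//.
rewrite [leRHS]ger0_norm; last first.
  by rewrite addr_ge0// mulr_ge0// addr_ge0// mulr_ge0.
by rewrite -mulrDr ler_wpM2l// -addrA lerD2l.
Qed.

Lemma ge0_integral_random_map h f : measurable_fun setT f -> (forall y, 0 <= f y)%E ->
  (\int[k h]_y f y = \int[P]_w f (F h w))%E.
Proof.
move=> mf f0; rewrite (eq_measure_integral (distribution P (F h))).
  by rewrite ge0_integral_distribution.
by move=> A mA _; rewrite kE.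
Qed.

Lemma kernel_op_random_map N f h : wbound N f -> kernel_op k f h = \int[P]_w f (F h w).
Proof.
move=> fN; have [mf _] := fN; rewrite /kernel_op /Rintegral; congr fine.
rewrite (eq_measure_integral (distribution P (F h))).
  rewrite integral_distribution//; first exact/measurable_EFinP.
  exact: weight_bounded_map fN.
by move=> A mA _; rewrite kE.
Qed.

(** Integrating the drift bound gives [N * (1 + b * L h + K)], and [b < 1]. *)
Lemma kernel_op_weight_bounded N f : wbound N f -> wbound (N * (1 + K)) (kernel_op k f).
Proof.
move=> fN; have N0 := weight_bounded_ge0 fN; have [mf Nf] := fN; split.
  exact: Rintegral_kernel_measurable.
move=> h; rewrite (kernel_op_random_map _ fN).
apply: (le_trans (le_normr_Rintegral measurableT (weight_bounded_map h fN))).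
apply: (@le_trans _ _ (\int[P]_w (N * (1 + b * L h) + N * ell w))).
  apply: le_Rintegral => //.
    exact/integrable_norm/(weight_bounded_map h fN).
  move=> w _; apply: (le_trans (Nf _)).
  by rewrite -mulrDr ler_wpM2l// -addrA lerD2l.
rewrite Rintegral_affine -mulrDr -mulrA ler_wpM2l//.
have : b * L h <= L h by rewrite ler_piMl// ltW.
have : 0 <= K * L h by rewrite mulr_ge0.
by move: (L_ge0 h) K_ge0; nra.
Qed.

(** This makes weight-bounded functions integrable under every [nstep k n h]. Only finiteness
    matters, so [N] may grow with [n]: each step costs a factor [1 + K]. *)
Lemma nstep_integral_weight n : exists N : R,
  forall h, (\int[nstep k n h]_y (1 + L y)%:E <= (N * (1 + L h))%:E)%E.
Proof.
have L1_ge0 h : (0 <= (1 + L h)%:E)%E by rewrite lee_fin addr_ge0.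
have mL1 : measurable_fun setT (fun h => (1 + L h)%:E).
  by apply/measurable_EFinP/measurable_funD.
elim: n => [|n [N IH]].
  exists 1 => h; rewrite mul1r /= /kdirac integral_dirac//.
  by rewrite diracT mul1e.
exists (N * (1 + K)) => h.
rewrite (@ge0_integral_mixture _ _ _ _ _ _ _ k (nstep k n) h)//.
have N0 : 0 <= N.
  have := le_trans (integral_ge0 _ (fun y _ => L1_ge0 y)) (IH point).
  by rewrite lee_fin pmulr_lge0// ltr_pwDl.
apply: (@le_trans _ _ (\int[k h]_y (N * (1 + L y))%:E)%E).
  apply: ge0_le_integral => //.
  - by move=> y _; apply: integral_ge0 => z _.
  - apply: measurable_fun_integral_kernel => // U mU.
    exact: measurable_kernel.
  - by apply/measurable_EFinP/measurable_funM => //; exact: measurable_funD.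
have wN : wbound N (fun y => N * (1 + L y)).
  split; first by apply: measurable_funM => //; exact: measurable_funD.
  by move=> y; rewrite ger0_norm// mulr_ge0// addr_ge0.
have kN : (\int[k h]_y (N * (1 + L y))%:E)%E \is a fin_num.
  rewrite ge0_integral_random_map.
  - exact: integrable_fin_num (weight_bounded_map h wN).
  - by apply/measurable_EFinP; case: wN.
  - by move=> y; rewrite lee_fin mulr_ge0// addr_ge0.
rewrite -(fineK kN) lee_fin.
by rewrite (le_trans _ ((kernel_op_weight_bounded wN).2 h))// ler_norm.
Qed.

Lemma nstep_integrable n N f h : wbound N f ->
  (nstep k n h).-integrable setT (EFin \o f).
Proof.
move=> fN; have N0 := weight_bounded_ge0 fN; have [mf Nf] := fN.
have [M hM] := nstep_integral_weight n.
apply/integrableP; split; first exact/measurable_EFinP.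
apply: (@le_lt_trans _ _ (N%:E * \int[nstep k n h]_y (1 + L y)%:E)%E).
  have L1_ge0 y : (0 <= (1 + L y)%:E)%E by rewrite lee_fin addr_ge0.
  have mL1 : measurable_fun setT (fun h => (1 + L h)%:E).
    by apply/measurable_EFinP/measurable_funD.
  rewrite -ge0_integralZl_EFin//; apply: ge0_le_integral => //.
  - by apply/measurable_EFinP; exact: measurableT_comp.
  - exact: measurable_funeM.
  - by move=> y _; rewrite /= lee_fin.
apply: (@le_lt_trans _ _ (N%:E * (M * (1 + L h))%:E)%E); last by rewrite ltry.
by rewrite lee_wpmul2l ?lee_fin.
Qed.

Lemma kernel_op_nstep0 N f h : wbound N f -> kernel_op (nstep k 0) f h = f h.
Proof.
move=> [mf _]; rewrite /kernel_op /Rintegral /= /kdirac integral_dirac//.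
  by rewrite diracT mul1e.
exact/measurable_EFinP.
Qed.

Lemma kernel_op_nstepS n N f h : wbound N f ->
  kernel_op (nstep k n.+1) f h = kernel_op k (kernel_op (nstep k n) f) h.
Proof.
move=> fN; apply: (@Rintegral_mixture _ _ _ _ _ _ _ k (nstep k n) h) => //.
  exact: (nstep_integrable n.+1 h fN).
by move=> y; exact: nstep_integrable fN.
Qed.

Lemma nstep_weight_bounded n N f : wbound N f ->
  exists M, wbound M (kernel_op (nstep k n) f).
Proof.
move=> fN; elim: n => [|n [M IH]].
  exists N; rewrite (_ : kernel_op _ _ = f)//; apply/funext => h.
  exact: kernel_op_nstep0 fN.
exists (M * (1 + K)).
rewrite (_ : kernel_op _ _ = kernel_op k (kernel_op (nstep k n) f)).
  exact: kernel_op_weight_bounded.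
by apply/funext => h; exact: kernel_op_nstepS fN.
Qed.

(** * Contraction of the weighted distance *)

Hypothesis coalescence : forall r : R, exists G : set Omega,
  [/\ measurable G, (0 < P G)%E &
    forall w h h', G w -> L h <= r -> L h' <= r -> F h w = F h' w].

(* Synchronous coupling: the chains started at h and h' are driven by the same
   w, so they coalesce on the event G when L h + L h' <= r, whereas for
   L h + L h' > r the drift already contracts the weight. *)
Lemma kernel_op_contraction : exists beta rho : R, [/\ 0 < beta, 0 < rho < 1 &
  forall N D f, wbound N f -> 0 <= D ->
    (forall h h', `|f h - f h'| <= D * (2 + beta * (L h + L h'))) ->
    forall h h', `|kernel_op k f h - kernel_op k f h'| <=
      rho * D * (2 + beta * (L h + L h'))].
Proof.
have b1 : 0 < 1 - b by rewrite subr_gt0.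
have K1 : 0 < K + 1 by rewrite ltr_wpDl.
(* Beyond this level, half of the drift gain, [(1 - b) / 2 * S], already exceeds the noise term
   [2 * K]. *)
pose r := 4 * (K + 1) / (1 - b).
have r0 : 0 < r by rewrite divr_gt0// mulr_gt0.
have [G [mG PG0 GF]] := coalescence r.
pose alpha := fine (P G).
have PGE : P G = alpha%:E by rewrite fineK// fin_num_measure.
have alpha0 : 0 < alpha by rewrite -lte_fin -PGE.
have alpha1 : alpha <= 1 by rewrite -lee_fin -PGE probability_le1.
(* Chosen so that [2 * beta * K <= alpha]: the noise uses up at most half of the gain [2 * alpha]
   due to coalescence. *)
pose beta := alpha / (2 * (K + 1)).
have beta0 : 0 < beta by rewrite divr_gt0// mulr_gt0.
have beta_ge0 := ltW beta0.
have betaE : 2 * beta * (K + 1) = alpha by rewrite /beta; field; rewrite gt_eqF.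
have br0 : 0 < beta * r by rewrite mulr_gt0.
have rE : (1 - b) * r = 4 * (K + 1) by rewrite /r; field; rewrite gt_eqF.
clearbody r alpha beta.
(* The ratio [(2 + beta * S * ((1 + b) / 2)) / (2 + beta * S)] decreases in [S]; [rho3] is its value
   at [r], hence a bound for [S > r]. The other two rates in [rho] serve the case [S <= r]. *)
pose rho3 := (2 + beta * r * ((1 + b) / 2)) / (2 + beta * r).
have d0 : 0 < 2 + beta * r by lra.
have rho3E : rho3 * (2 + beta * r) = 2 + beta * r * ((1 + b) / 2).
  by rewrite /rho3; field; rewrite gt_eqF.
pose rho := Num.max (1 - alpha / 2) (Num.max b rho3).
have [rho_a [rho_b rho_3]] : 1 - alpha / 2 <= rho /\ b <= rho /\ rho3 <= rho.
  by rewrite /rho !le_max !lexx !orbT.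
have rho1 : rho < 1.
  rewrite /rho !gt_max b_lt1 /rho3 ltr_pdivrMr// mul1r.
  by apply/and3P; split => //; nra.
exists beta, rho; split => //; first by rewrite rho1 andbT; lra.
move=> N D f fN D0 fD h h'.
set S := L h + L h'.
have S0 : 0 <= S by rewrite addr_ge0.
have FS w : L (F h w) + L (F h' w) <= b * S + 2 * ell w.
  by move: (drift h w) (drift h' w); rewrite /S; lra.
have fF w : `|f (F h w) - f (F h' w)| <=
    D * (2 + beta * (b * S)) + D * (2 * beta) * ell w.
  apply: (le_trans (fD _ _)); rewrite -mulrA -mulrDr ler_wpM2l//.
  by move: (ler_wpM2l (ltW beta0) (FS w)); lra.
have iB : P.-integrable setT (EFin \o (fun w => f (F h w) - f (F h' w))).
  rewrite (_ : _ \o _ = (EFin \o (f \o F h)) \- (EFin \o (f \o F h')))%E//.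
  by apply: integrableB => //; exact: weight_bounded_map fN.
rewrite !(kernel_op_random_map _ fN) -RintegralB//; [|exact: weight_bounded_map fN..].
apply: (le_trans (le_normr_Rintegral measurableT iB)).
have [Sr|rS] := leP S r.
  (* On [G] the two images coincide, so the constant [2 * D] can be removed from the bound there
     while it stays nonnegative. *)
  pose g w := (D * (2 + beta * (b * S)) + D * (2 * beta) * ell w)
    - (2 * D) * \1_G w.
  have iG : P.-integrable setT (EFin \o (fun w => 2 * D * \1_G w)).
    rewrite (_ : _ \o _ = (fun w => (2 * D)%:E * (EFin \o \1_G) w))%E.
      by apply: integrableZl => //; exact: integrable_indic.
    by apply/funext => w; rewrite /= EFinM.
  have iG1 : P.-integrable setT (EFin \o \1_G) by exact: integrable_indic.
  have ig : P.-integrable setT (EFin \o g).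
    rewrite (_ : _ \o _ = (EFin \o
      (fun w => D * (2 + beta * (b * S)) + D * (2 * beta) * ell w)%R) \-
      (EFin \o (fun w => 2 * D * \1_G w)%R))%E//.
    exact: integrableB.
  apply: (@le_trans _ _ (\int[P]_w g w)).
    apply: le_Rintegral => //; first exact: integrable_norm.
    move=> w _; rewrite /g indicE; have [/set_mem Gw|_] := boolP (w \in G).
      have [hr h'r] : L h <= r /\ L h' <= r.
        by move: (L_ge0 h) (L_ge0 h') Sr; rewrite /S; lra.
      rewrite (GF w h h')// subrr normr0 /=.
      have : 0 <= D * (beta * (b * S)) by do !apply: mulr_ge0.
      have : 0 <= D * (2 * beta) * ell w by do !apply: mulr_ge0.
      lra.
    by rewrite mulr0 subr0.
  have EG : \int[P]_w (\1_G w : R) = alpha.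
    by rewrite /Rintegral integral_indic// setIT; exact: (congr1 fine PGE).
  rewrite RintegralB// Rintegral_affine RintegralZl// EG.
  have -> : D * (2 + beta * (b * S)) + D * (2 * beta) * K - 2 * D * alpha =
      D * (2 + b * (beta * S) + 2 * beta * K - 2 * alpha) by ring.
  have -> : rho * D * (2 + beta * S) = D * (rho * (2 + beta * S)) by ring.
  rewrite ler_wpM2l//.
  have : b * (beta * S) <= rho * (beta * S) by rewrite ler_wpM2r// mulr_ge0.
  lra.
(* For [S > r] the drift alone suffices. *)
apply: (@le_trans _ _ (\int[P]_w (D * (2 + beta * (b * S)) + D * (2 * beta) * ell w))).
  by apply: le_Rintegral => //; exact: integrable_norm.
rewrite Rintegral_affine.
have -> : D * (2 + beta * (b * S)) + D * (2 * beta) * K =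
  D * (2 + beta * (b * S) + 2 * beta * K) by ring.
have -> : rho * D * (2 + beta * S) = D * (rho * (2 + beta * S)) by ring.
rewrite ler_wpM2l//.
have h1 : (1 - b) * r <= (1 - b) * S by rewrite ler_wpM2l// ltW.
have h2 : beta * (2 * K) <= beta * ((1 - b) / 2 * S).
  by rewrite ler_wpM2l//; lra.
apply: (@le_trans _ _ (2 + beta * S * ((1 + b) / 2))); first by lra.
apply: (@le_trans _ _ (rho3 * (2 + beta * S))).
  rewrite /rho3 [leRHS]mulrAC ler_pdivlMr//.
  have : beta * ((1 - b) * r) <= beta * ((1 - b) * S) by rewrite ler_wpM2l// ltW.
  by lra.
by rewrite ler_wpM2r// addr_ge0// mulr_ge0.
Qed.

(** Each step multiplies [D] by the same [rho]; the weight bound of the iterates supplies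
    integrability and does not enter the rate. *)
Lemma nstep_contraction : exists beta rho : R, [/\ 0 < beta, 0 < rho < 1 &
  forall n N D f, wbound N f -> 0 <= D ->
    (forall h h', `|f h - f h'| <= D * (2 + beta * (L h + L h'))) ->
    forall h h',
      `|kernel_op (nstep k n) f h - kernel_op (nstep k n) f h'| <=
      rho ^+ n * D * (2 + beta * (L h + L h'))].
Proof.
have [beta [rho [beta0 rho01 contr]]] := kernel_op_contraction.
exists beta, rho; split => // n N D f fN D0 fD.
elim: n => [|n IH] h h'.
  by rewrite !(kernel_op_nstep0 _ fN) expr0 mul1r.
have [M fM] := nstep_weight_bounded n fN.
rewrite !(kernel_op_nstepS _ _ fN) exprS -(mulrA rho).
apply: (contr _ _ _ fM _ IH); rewrite mulr_ge0// exprn_ge0//.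
by case/andP : rho01 => /ltW.
Qed.

(** * Integration against an invariant measure *)

Section invariant.
Variable p : probability X R.
Hypothesis p_inv : invariant_measure k p.

Lemma invariant_kernel_op N f : wbound N f -> p.-integrable setT (EFin \o f) ->
  \int[p]_h kernel_op k f h = \int[p]_h f h.
Proof.
move=> fN pf; apply/esym.
(* Seen as a kernel from [unit], [p] becomes a mixture of [k] over itself, which is what invariance
   says. *)
have mp : measurable_fun setT (fun _ : unit => p : pprobability X R).
  exact: measurable_cst.
apply: (@Rintegral_mixture _ _ _ _ _ _ _ (kprobability mp) k tt) => //.
  by move=> B mB; rewrite /kprobability /= p_inv.
move=> h; apply/integrableP; split; first by apply/measurable_EFinP; case: fN.
rewrite ge0_integral_random_map//.
  by have /integrableP[] := weight_bounded_map h fN.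
by apply/measurable_EFinP; apply: measurableT_comp => //; case: fN.
Qed.

(* Integrating (1 - b) L 1_{L < m} <= min(L, m) - P min(L, m) + K against p,
   the two middle terms cancel by invariance. *)
Lemma invariant_integrable : p.-integrable setT (EFin \o L).
Proof.
have b1 : 0 < 1 - b by rewrite subr_gt0.
pose A (m : nat) := [set h | L h < m%:R].
have mA m : measurable (A m).
  rewrite (_ : A m = L @^-1` `]-oo, m%:R[%classic).
    by rewrite -[_ @^-1` _]setTI; exact: L_meas.
  by apply/seteqP; split => h; rewrite /A /= in_itv.
have ltA m : (\int[p]_(h in A m) (L h)%:E <= (K / (1 - b))%:E)%E.
  (* Truncation gives a bounded function, so that invariance applies before [L] is known to be
     integrable. *)
  pose f h := Num.min (L h) m%:R.
  have mf : measurable_fun setT f by exact: measurable_minr.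
  have f0 h : 0 <= f h by rewrite le_min L_ge0 ler0n.
  have fN : wbound 1 f.
    split => // h; rewrite ger0_norm// mul1r /f ge_min.
    by rewrite ler_wpDl.
  have m_int : p.-integrable setT (EFin \o cst (m%:R : R)).
    exact: finite_measure_integrable_cst.
  have fint : p.-integrable setT (EFin \o f).
    apply: (le_integrable measurableT _ _ m_int).
      exact/measurable_EFinP.
    move=> h _; rewrite /= lee_fin ger0_norm// ger0_norm//.
    by rewrite /f ge_min lexx orbT.
  have Pf_m h : 0 <= kernel_op k f h <= m%:R.
    rewrite (kernel_op_random_map _ fN) Rintegral_ge0//=.
    have -> : m%:R = \int[P]_w (m%:R : R).
      by rewrite Rintegral_cst// [X in fine X]probability_setT mulr1.
    apply: le_Rintegral => //; [exact: weight_bounded_map fN|exact: cst_int|].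
    by move=> w _; rewrite /f ge_min lexx orbT.
  have Pf_L h : kernel_op k f h <= b * L h + K.
    rewrite (kernel_op_random_map _ fN) -[K]mul1r -Rintegral_affine.
    apply: le_Rintegral => //; first exact: weight_bounded_map fN.
    by move=> w _; rewrite mul1r /f ge_min drift.
  have mPf : measurable_fun setT (kernel_op k f).
    by case: (kernel_op_weight_bounded fN).
  have Pfint : p.-integrable setT (EFin \o kernel_op k f).
    apply: (le_integrable measurableT _ _ m_int).
      exact/measurable_EFinP.
    move=> h _; have /andP[Pf0 Pfm] := Pf_m h.
    by rewrite /= lee_fin ger0_norm// ger0_norm.
  pose g h := f h - kernel_op k f h + K.
  have gint : p.-integrable setT (EFin \o g).
    rewrite (_ : _ \o _ = ((EFin \o f) \- (EFin \o kernel_op k f)) \+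
      (EFin \o cst K))%E//.
    apply: integrableD => //; first exact: integrableB.
    exact: finite_measure_integrable_cst.
  have gE : \int[p]_h g h = K.
    rewrite RintegralD//; last 2 first.
    - rewrite (_ : _ \o _ = ((EFin \o f) \- (EFin \o kernel_op k f)))%E//.
      exact: integrableB.
    - exact: finite_measure_integrable_cst.
    rewrite RintegralB// (invariant_kernel_op fN)// subrr add0r.
    by rewrite Rintegral_cst// [X in fine X]probability_setT mulr1.
  (* Where [L h >= m], [f h = m] dominates [kernel_op k f h]; elsewhere the drift bound does.
     Nonnegativity later allows enlarging [A m] to the whole space. *)
  have g0 h : 0 <= g h.
    rewrite /g /f; have /andP[_] := Pf_m h; have := Pf_L h; move: K_ge0.
    have : b * L h <= L h by rewrite ler_piMl// ltW.
    by have [] := leP (L h) m%:R; lra.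
  have mg : measurable_fun setT g by exact/measurable_EFinP/(measurable_int p).
  have mg' : measurable_fun setT (fun h => ((1 - b)^-1 * g h)%:E).
    by apply/measurable_EFinP; exact: measurable_funM.
  have g'0 h : 0 <= (1 - b)^-1 * g h by rewrite mulr_ge0// invr_ge0 ltW.
  apply: (@le_trans _ _ (\int[p]_(h in A m) ((1 - b)^-1 * g h)%:E)%E).
    apply: ge0_le_integral => //.
    - by move=> h _; rewrite lee_fin.
    - by apply: measurable_funTS; exact/measurable_EFinP.
    - exact: measurable_funTS.
    - move=> h Am; rewrite lee_fin ler_pdivlMl// /g.
      have -> : f h = L h by rewrite /f min_l// ltW.
      by have := Pf_L h; lra.
  apply: (@le_trans _ _ (\int[p]_h ((1 - b)^-1 * g h)%:E)%E).
    by apply: ge0_subset_integral => // h _; rewrite lee_fin.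
  under eq_integral do rewrite EFinM.
  rewrite ge0_integralZl_EFin//; last 3 first.
  - by move=> h _; rewrite lee_fin.
  - exact/measurable_EFinP.
  - by rewrite invr_ge0 ltW.
  have -> : (\int[p]_h (g h)%:E)%E = K%:E.
    by rewrite -gE fineK//; exact: integrable_fin_num.
  by rewrite -EFinM mulrC.
apply/integrableP; split; first exact/measurable_EFinP.
under eq_integral do rewrite gee0_abs ?lee_fin//.
have AT : \bigcup_m A m = setT.
  apply/seteqP; split => // h _; exists (Num.truncn (L h)).+1 => //.
  by rewrite /A /= truncnS_gt.
apply: (@le_lt_trans _ _ (K / (1 - b))%:E); last exact: ltry.
(* Monotone convergence along the sets [A m] removes the truncation, the bound being independent of
   [m]. *)
rewrite -AT.
have ndA : nondecreasing_seq A.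
  move=> m n mn; apply/subsetPset => h; rewrite /A /= => /lt_le_trans; apply.
  by rewrite ler_nat.
have mL m : measurable_fun (A m) (EFin \o L).
  by apply: measurable_funTS; exact/measurable_EFinP.
have L0 m h : A m h -> (0 <= (EFin \o L) h)%E by rewrite lee_fin.
rewrite -(cvg_lim _ (ge0_nondecreasing_set_cvg_integral ndA mA mL L0))//.
apply: lime_le; last by apply: nearW => m; exact: ltA.
apply/cvg_ex; eexists; exact: ge0_nondecreasing_set_cvg_integral ndA mA mL L0.
Qed.

(** The contraction between [h] and [y] is integrated over [y] under [p]. The bound [N] on [f]
    serves integrability; the bound [M] on the centred function is the one in the estimate. *)
Theorem geometric_ergodicity : exists C rho : R, [/\ 0 < C, 0 < rho < 1 &
  forall n N M f, wbound N f ->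
    (forall h, `|f h - \int[p]_y f y| <= M * (1 + L h)) ->
    forall h, `|kernel_op (nstep k n) f h - \int[p]_y f y| <=
      C * rho ^+ n * M * (1 + L h)].
Proof.
have [beta [rho [beta0 rho01 contr]]] := nstep_contraction.
have /andP[rho0 rho1] := rho01.
have pL := invariant_integrable.
pose E : R := \int[p]_h L h.
have E0 : 0 <= E by exact: Rintegral_ge0.
have wint N f : wbound N f -> p.-integrable setT (EFin \o f).
  move=> [mf fN].
  apply: (@le_integrable _ _ _ p _ measurableT _ (EFin \o (fun h => N * (1 + L h)))).
  - exact/measurable_EFinP.
  - by move=> h _; rewrite /= lee_fin (le_trans (fN h))// ler_norm.
  - rewrite (_ : _ \o _ = (fun h => N%:E * (EFin \o (fun h => 1 + L h)%R) h)%E).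
      apply: integrableZl => //.
      rewrite (_ : _ \o _ = (EFin \o cst 1%R) \+ (EFin \o L))%E//.
      by apply: integrableD => //; exact: finite_measure_integrable_cst.
    by apply/funext => h'; rewrite /= EFinM.
(* Both [B] and [B * beta] are at least 1, so [2 + S <= B * (2 + beta * S)] converts the weight of
   the norm into that of the distance. *)
pose B := 1 + beta^-1.
have B0 : 0 < B by rewrite addr_gt0 ?invr_gt0.
have B1 : 1 <= B by rewrite lerDl invr_ge0 ltW.
have Bb : 1 <= B * beta by rewrite /B mulrDl mul1r mulVf ?gt_eqF// lerDr ltW.
exists (B * (2 + beta + beta * E)), rho; split => //.
  have : 0 <= beta * E by rewrite mulr_ge0// ltW.
  by move=> ?; apply: mulr_gt0 => //; lra.
move=> n N M f fN fM h.
have M0 : 0 <= M.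
  by have := le_trans (normr_ge0 _) (fM point); rewrite pmulr_lge0// ltr_pwDl.
have fD y z : `|f y - f z| <= M * B * (2 + beta * (L y + L z)).
  apply: (le_trans (ler_distD (\int[p]_y f y) _ _)).
  rewrite [X in _ + X]distrC; apply: (le_trans (lerD (fM y) (fM z))).
  rewrite -mulrDr -mulrA ler_wpM2l//.
  have : 1 * (L y + L z) <= B * beta * (L y + L z) by rewrite ler_wpM2r// addr_ge0.
  by lra.
have MB0 : 0 <= M * B by rewrite mulr_ge0// ltW.
have nD := contr n N _ f fN MB0 fD h.
set q := kernel_op (nstep k n) f in nD *.
have [N' qN] : exists N', wbound N' q by exact: nstep_weight_bounded fN.
have qint := wint _ _ qN.
(* Invariance, applied [n] times, turns the centring constant into the mean of the iterate. *)
have -> : \int[p]_y f y = \int[p]_y q y.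
  rewrite /q; elim: n {nD q N' qN qint} => [|n IH].
    by apply: eq_Rintegral => y _; rewrite (kernel_op_nstep0 _ fN).
  have [N' qN] := nstep_weight_bounded n fN.
  rewrite IH -(invariant_kernel_op qN (wint _ _ qN)).
  by apply: eq_Rintegral => y _; rewrite (kernel_op_nstepS _ _ fN).
have cint (c : R) : p.-integrable setT (EFin \o cst c).
  exact: finite_measure_integrable_cst.
have -> : q h = \int[p]_y q h.
  by rewrite Rintegral_cst// [X in fine X]probability_setT mulr1.
rewrite -RintegralB//; last exact: cint.
have dint : p.-integrable setT (EFin \o (fun y => q h - q y)).
  rewrite (_ : _ \o _ = (EFin \o cst (q h)) \- (EFin \o q))%E//.
  exact: integrableB.
apply: (le_trans (le_normr_Rintegral measurableT dint)).
pose c := rho ^+ n * (M * B).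
have c0 : 0 <= c by rewrite mulr_ge0// exprn_ge0// ltW.
have bLint : p.-integrable setT (EFin \o (fun y => c * beta * L y)).
  rewrite (_ : _ \o _ = (fun y => (c * beta)%:E * (EFin \o L) y))%E.
    exact: integrableZl.
  by apply/funext => y; rewrite /= EFinM.
apply: (@le_trans _ _ (\int[p]_y (c * (2 + beta * L h) + c * beta * L y))).
  apply: le_Rintegral => //; first exact: integrable_norm.
    rewrite (_ : _ \o _ = (EFin \o cst (c * (2 + beta * L h))%R) \+
      (EFin \o (fun y => c * beta * L y)%R))%E//.
    exact: integrableD.
  move=> y _; apply: (le_trans (nD y)).
  by rewrite -/c -(mulrA c) -mulrDr; apply: ler_wpM2l => //; lra.
rewrite RintegralD// ?cint//.
rewrite (RintegralZl (c * beta) measurableT pL) -/E.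
rewrite Rintegral_cst// [X in fine X]probability_setT mulr1.
have -> : B * (2 + beta + beta * E) * rho ^+ n * M * (1 + L h) =
  c * ((2 + beta + beta * E) * (1 + L h)) by rewrite /c; ring.
rewrite -(mulrA c) -mulrDr ler_wpM2l//.
have : 0 <= beta * E * L h by rewrite !mulr_ge0// ltW.
have : 0 <= L h by [].
by lra.
Qed.

End invariant.

End iterated_random_map.

(** * The weight on positive continuous functions *)

Section sup_norm_power.
Context {R : realType}.
Implicit Types (g h z : CS2 R) (gamma : R).

Lemma CS2_le_supnorm h x : h x <= supnorm h.
Proof.
by apply: le_trans (ler_norm _) (supnorm_ub _ _); exact: CS2_continuous.
Qed.

Lemma CS2_supnorm_le h M : (forall x, h x <= M) -> supnorm h <= M.
Proof. by move=> hM; apply: supnorm_le => x; rewrite gtr0_norm// CS2_gt0. Qed.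

Lemma CS2_supnorm_ge0 h : 0 <= supnorm h.
Proof. exact: le_trans (ltW (CS2_gt0 h point)) (CS2_le_supnorm _ _). Qed.

(** The power is increasing on nonnegative reals, with inverse the power [gamma^-1]; each inequality
    transports a pointwise bound through one of them. *)
Lemma supnorm_powR gamma h : 0 < gamma ->
  supnorm (fun x => h x `^ gamma) = supnorm h `^ gamma.
Proof.
move=> gamma0; have hub x : `|h x `^ gamma| <= supnorm h `^ gamma.
  rewrite ger0_norm ?powR_ge0// ge0_ler_powR ?nnegrE//.
  - exact: ltW.
  - exact/ltW/CS2_gt0.
  - exact: CS2_supnorm_ge0.
  - exact: CS2_le_supnorm.
apply/le_anti/andP; split; first exact: supnorm_le.
set l := supnorm (fun x => h x `^ gamma).
have hl x : h x `^ gamma <= l.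
  apply: le_trans (ler_norm _) _; apply: ub_le_sup; last by exists x.
  by exists (supnorm h `^ gamma) => _ [y _ <-].
have l0 : 0 <= l by exact: le_trans (powR_ge0 _ _) (hl point).
have -> : l = (l `^ gamma^-1) `^ gamma.
  by rewrite -powRrM mulVf ?gt_eqF// powRr1.
apply: ge0_ler_powR; rewrite ?nnegrE ?powR_ge0 ?CS2_supnorm_ge0//; first exact: ltW.
apply: CS2_supnorm_le => x.
have -> : h x = (h x `^ gamma) `^ gamma^-1.
  by rewrite -powRrM mulfV ?gt_eqF// powRr1//; exact/ltW/CS2_gt0.
by apply: ge0_ler_powR; rewrite ?nnegrE ?powR_ge0 ?invr_ge0// ltW.
Qed.

(** The norm is 1-Lipschitz, so its strict superlevel sets are open. *)
Lemma supnorm_measurable : measurable_fun setT (fun h => supnorm h : R).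
Proof.
apply: (measurability _ (RGenOInfty.measurableE R)) => _ [_ [c ->]] <-.
rewrite setTI; apply: CS2_open_measurable; apply/CS2_openP => h /=.
rewrite in_itv/= andbT => ch; exists (supnorm h - c); first by rewrite subr_gt0.
move=> g; rewrite ballEmdist /= in_itv/= andbT => hg.
have : supnorm h <= supnorm g + mdist h g.
  apply: CS2_supnorm_le => x; rewrite -[h x](subrK (g x)) addrC lerD//.
    exact: CS2_le_supnorm.
  exact: le_trans (ler_norm _) (CS2_dist_ub _ _ _).
lra.
Qed.

Lemma supnorm_powR_measurable gamma : 0 < gamma ->
  measurable_fun setT (fun h => supnorm (fun x => h x `^ gamma)).
Proof.
move=> gamma0; under eq_fun do rewrite supnorm_powR//.
exact: (measurableT_comp (measurable_powR gamma) supnorm_measurable).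
Qed.

Lemma CS2_ge_measurable (s : R) : measurable [set z : CS2 R | forall x, s <= z x].
Proof.
rewrite -[X in measurable X]setCK; apply: measurableC; apply: CS2_open_measurable.
apply/CS2_openP => h /existsNP[x /negP]; rewrite -ltNge => hxs.
exists (s - h x); first by rewrite /= subr_gt0.
move=> g; rewrite ballEmdist /= => hg /(_ x).
have := le_trans (ler_norm _) (CS2_dist_ub g h x).
move: hg; rewrite metric_sym /mdist /=; lra.
Qed.

Section step.
Variables (a theta : R) (u : S2 R).
Hypotheses (a_ge0 : 0 <= a) (a_le1 : a <= 1).

(** Source of the drift: the power of a maximum is one of the two powers, hence at most their
    sum. *)
Lemma supnorm_powR_max_step gamma h z : 0 < gamma ->
  supnorm (fun x => max_step a theta u h z x `^ gamma) <=
  a `^ gamma * supnorm (fun x => h x `^ gamma) +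
  (1 - a) `^ gamma * supnorm (fun x => z x `^ gamma).
Proof.
move=> gamma0; have a1 : 0 <= 1 - a by rewrite subr_ge0.
rewrite !supnorm_powR// -!powRM ?CS2_supnorm_ge0//.
apply: (@le_trans _ _ (Num.max (a * supnorm h) ((1 - a) * supnorm z) `^ gamma)).
  rewrite ge0_ler_powR ?nnegrE ?CS2_supnorm_ge0//; first exact: ltW.
    by rewrite le_max mulr_ge0// CS2_supnorm_ge0.
  apply: CS2_supnorm_le => x; rewrite max_stepE ge_max !le_max.
  by rewrite !ler_wpM2l ?CS2_le_supnorm ?orbT.
by case: (leP (a * supnorm h) ((1 - a) * supnorm z)) => _;
  rewrite ?lerDl ?lerDr powR_ge0.
Qed.

(** The noise wins the maximum at every point, so the new state is [(1 - a) * z] whatever the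
    start. *)
Lemma max_step_coalescence (s : R) h h' z : (forall x, s <= z x) ->
  a * supnorm h <= (1 - a) * s -> a * supnorm h' <= (1 - a) * s ->
  max_step a theta u h z = max_step a theta u h' z.
Proof.
move=> sz hs h's; apply: CS2_ext => x; rewrite !max_stepE.
have sz' : (1 - a) * s <= (1 - a) * z x by rewrite ler_wpM2l// subr_ge0.
have le_step g : a * supnorm g <= (1 - a) * s ->
    a * g (Defs.rot theta u x) <= (1 - a) * z x.
  move=> gs; apply: le_trans sz'; apply: le_trans gs.
  by rewrite ler_wpM2l// CS2_le_supnorm.
by rewrite !max_r// le_step.
Qed.

End step.

End sup_norm_power.

(** * The von Mises-Fisher process *)

Section von_mises_fisher.
Context {R : realType}.

(** The longitude contributes [2 * pi], and [sin], with primitive [- cos], integrates to 2 over the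
    colatitude. *)
Lemma surface_measure_setT : surface_measure [set: S2 R] = (4 * pi)%:E.
Proof.
have pi0 := @pi_gt0 R; rewrite /surface_measure.
have inner phi : (\int[lebesgue_measure]_(psi in `[0%R, (2 * pi)%R])
    (sin phi * \1_[set: S2 R] (spherical phi psi))%:E =
    (sin phi)%:E * (2 * pi)%:E)%E.
  under eq_integral do rewrite indicT mulr1.
  rewrite integral_cst//; congr (_ * _)%E.
  rewrite [LHS]lebesgue_measure_itv/= lte_fin mulr_gt0//.
  by rewrite -EFinB subr0.
under eq_integral do rewrite inner.
have sin0 phi : phi \in `[0, pi]%classic -> (0 <= (@sin R phi)%:E)%E.
  by rewrite inE => /= phi_pi; rewrite lee_fin sin_ge0_pi.
rewrite ge0_integralZr//; last first.
- by rewrite lee_fin mulr_ge0// ltW.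
- by move=> phi phi_pi; apply: sin0; rewrite inE.
- apply/measurable_EFinP; apply: measurable_funTS; apply: continuous_measurable_fun.
  exact: continuous_sin.
have cN : continuous (fun x : R => - cos x).
  move=> x; apply: (@continuousN _ R^o _ cos); exact: continuous_cos.
rewrite (@continuous_FTC2 R sin (fun x => - cos x))//.
- by rewrite cospi cos0 -EFinB -EFinM; congr EFin; ring.
- by apply: continuous_subspaceT; exact: continuous_sin.
- split.
  + by move=> x _; apply: derivableN; exact: derivable_cos.
  + exact/cvg_at_right_filter/cN.
  + exact/cvg_at_left_filter/cN.
- move=> x _; rewrite derive1E deriveN; last exact: derivable_cos.
  by rewrite (@derive_val _ _ _ _ _ _ _ (is_derive_cos x)) opprK.
Qed.

(** The section at [v] is the whole sphere if [v > t] and empty otherwise, which leaves the integral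
    of [4 * pi * v ^- 2] beyond [t], with primitive [- (4 * pi) / v]. *)
Lemma intensity_ray (t : R) : 0 < t ->
  intensity (`]t, +oo[ `*` [set: S2 R]) = (4 * pi / t)%:E.
Proof.
move=> t0; have pi0 := @pi_gt0 R; rewrite /intensity.
pose f v : R := v ^- 2 * (4 * pi).
transitivity (\int[lebesgue_measure]_(v in `]0%R, +oo[)
    (((EFin \o f) \_ `]t, +oo[) v))%E.
  apply: eq_integral => v _; rewrite patchE.
  have [tv|tv] := boolP (v \in _).
    rewrite /xsection (_ : [set y | _] = setT) ?surface_measure_setT//.
    apply/seteqP; split => // y _ /=; rewrite inE; split => //.
    by rewrite inE in tv.
  rewrite /xsection (_ : [set y | _] = set0).
    rewrite /surface_measure integral0_eq ?mule0// => phi _.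
    by rewrite integral0_eq// => psi _; rewrite indic0 mulr0.
  apply/seteqP; split => // y /=; rewrite inE => -[/= tv' _].
  by move/negP : tv; apply; rewrite inE.
rewrite -integral_mkcondr.
rewrite (_ : _ `&` _ = `]t, +oo[%classic); last first.
  apply/seteqP; split => v /=; rewrite !in_itv/= !andbT; first by case.
  by move=> tv; split => //; exact: lt_trans tv.
have cf : {within `[t, +oo[, continuous f}.
  apply: continuous_in_subspaceT => v; rewrite inE/= in_itv/= andbT => tv.
  apply: (@continuousM _ _ (fun v : R => v ^- 2) (cst (4 * pi)));
    last exact: cst_continuous.
  apply: continuousV; last exact: exprn_continuous.
  by rewrite expf_neq0// gt_eqF// (lt_le_trans t0).
have mf : measurable_fun `]t, +oo[ (EFin \o f).
  apply/measurable_EFinP; apply: subspace_continuous_measurable_fun => //.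
  by apply: continuous_subspaceW cf; move=> v /=; rewrite !in_itv/= !andbT; exact: ltW.
rewrite integral_itv_obnd_cbnd//.
pose F (v : R) : R := - (4 * pi) * v^-1.
have dF (v : R) : 0 < v -> is_derive v 1 F (f v).
  move=> v0; rewrite (_ : f v = - (4 * pi) *: (- v ^- 2 *: 1)).
    have v0' : v != 0 by rewrite gt_eqF.
    exact: (is_deriveZ (- (4 * pi)) (@is_deriveV _ id v 1 1 v0' (is_derive_id v 1))).
  by rewrite /f /GRing.scale /=; ring.
have f_ge0 (v : R) : t <= v -> 0 <= f v.
  by move=> _; apply: mulr_ge0; rewrite ?invr_ge0 ?sqr_ge0// mulr_ge0// ltW.
have Foo : F v @[v --> +oo%R] --> 0.
  rewrite -(mulr0 (- (4 * pi))); apply: cvgMl_tmp.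
  apply/gtr0_cvgV0; last exact: cvg_id.
  exact: nbhs_pinfty_gt.
have dFt (v : R) : t < v -> derivable F v 1.
  by move=> tv; have [] := dF v (lt_trans t0 tv).
have Ft : F v @[v --> t^'+] --> F t.
  apply: cvg_at_right_filter; have [d _] := dF t t0.
  exact/differentiable_continuous/derivable1_diffP.
have F'f : {in `]t, +oo[, F^`()%classic =1 f}.
  move=> v; rewrite in_itv/= andbT => tv.
  by rewrite derive1E (@derive_val _ _ _ _ _ _ _ (dF v (lt_trans t0 tv))).
rewrite (ge0_continuous_FTC2y f_ge0 cf Foo dFt Ft F'f).
by rewrite -EFinB sub0r /F mulNr opprK.
Qed.

(** Twice [1 + dot3 x y] and twice [1 - dot3 x y] are the squared lengths of the sum and the
    difference. *)
Lemma dot3_norm_le1 (x y : S2 R) : `|dot3 (vec x) (vec y)| <= 1.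
Proof.
have := vecP x; have := vecP y; rewrite !dot3E.
set x0 := vec x 0 0; set x1 := vec x 1 0; set x2 := vec x 2 0.
set y0 := vec y 0 0; set y1 := vec y 1 0; set y2 := vec y 2 0 => hy hx.
have := sqr_ge0 (x0 - y0); have := sqr_ge0 (x1 - y1); have := sqr_ge0 (x2 - y2).
have := sqr_ge0 (x0 + y0); have := sqr_ge0 (x1 + y1); have := sqr_ge0 (x2 + y2).
by move=> *; rewrite ler_norml; apply/andP; split; nra.
Qed.

(** Uniformity in [mu] and [x] is what reduces the size of [Z] to that of the largest [U i]. *)
Lemma vmf_bounds (kappa : R) : 0 <= kappa -> exists m M : R,
  [/\ 0 < m, 0 < M & forall mu x, m <= vmf kappa mu x <= M].
Proof.
rewrite le_eqVlt => /orP[/eqP<-|kappa0]; have pi0 := @pi_gt0 R.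
  have pi4 : 0 < (4 * pi)^-1 :> R by rewrite invr_gt0 mulr_gt0.
  by exists (4 * pi)^-1, (4 * pi)^-1; split => // mu x; rewrite /vmf eqxx lexx.
pose c := kappa / (4 * pi * sinh kappa).
have c0 : 0 < c.
  rewrite divr_gt0// !mulr_gt0// subr_gt0 ltr_expR.
  by rewrite (lt_trans _ kappa0)// oppr_lt0.
exists (c * expR (- kappa)), (c * expR kappa).
split; [by rewrite mulr_gt0 ?expR_gt0..|move=> mu x].
rewrite /vmf gt_eqF// -/c !ler_pM2l// !ler_expR.
have := dot3_norm_le1 mu x; rewrite ler_norml => /andP[? ?].
by apply/andP; split; nra.
Qed.

End von_mises_fisher.

(** * Fractional moments from a tail of order 1/t *)

Section weak_moment.
Context {R : realType} d (T : measurableType d) (P : probability T R).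
Variables (X : T -> R) (c gamma : R).
Hypothesis X_meas : measurable_fun setT X.
Hypothesis X_ge0 : forall w, 0 <= X w.
Hypothesis gamma_gt0 : 0 < gamma.
Hypothesis gamma_lt1 : gamma < 1.
Hypothesis X_tail : forall t, 0 < t -> (P [set w | (t < X w)%R] <= (c / t)%:E)%E.

(* Dyadic layers: X^gamma <= 1 + \sum_k 2^((k+1) gamma) 1_{X > 2^k}. *)
Lemma weak_moment_integrable : P.-integrable setT (EFin \o (fun w => X w `^ gamma)).
Proof.
pose A k := [set w | 2 ^+ k < X w].
have mA k : measurable (A k).
  rewrite (_ : A k = X @^-1` `]2 ^+ k, +oo[%classic).
    by rewrite -[_ @^-1` _]setTI; exact: X_meas.
  by apply/seteqP; split => w; rewrite /A /= in_itv/= andbT.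
(* Ratio of the geometric series bounding the integrals of the layers; it is below 1 because
   [gamma < 1]. *)
pose q : R := (2 `^ gamma) / 2.
have q0 : 0 < q by rewrite divr_gt0// powR_gt0.
have q1 : q < 1.
  rewrite ltr_pdivrMr// mul1r /powR pnatr_eq0 /= -[ltRHS](@lnK _ 2) ?posrE//.
  by rewrite ltr_expR gtr_pMl// ln_gt0// ltr1n.
have p2 k : (2 ^+ k) `^ gamma = (2 `^ gamma) ^+ k.
  by rewrite -powR_mulrn// -powRrM mulrC powRrM powR_mulrn// powR_ge0.
pose f k w : \bar R := (((2 `^ gamma) ^+ k.+1) * \1_(A k) w)%:E.
have f0 k w : (0 <= f k w)%E.
  by rewrite lee_fin mulr_ge0// exprn_ge0// powR_ge0.
have mf k : measurable_fun setT (f k).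
  by apply/measurable_EFinP; apply: measurable_funM => //; exact: measurable_indic.
have Xf w : ((X w `^ gamma)%:E <= 1 + \sum_(k <oo) f k w)%E.
  have [n Xn] : exists n, X w <= 2 ^+ n.
    exists (Num.truncn (X w)).+1; apply: (le_trans (ltW (truncnS_gt (X w)))).
    by rewrite -natrX ler_nat ltnW// ltn_expl.
  have exn : exists n, X w <= 2 ^+ n by exists n.
  (* If the least exponent is 0, the constant 1 dominates; if it is [k.+1], then [X w] lies between
     consecutive powers and layer [k] alone dominates. *)
  case: (ex_minnP exn) => -[|k] Xk kmin.
    apply: (@le_trans _ _ 1%:E); last by rewrite leeDl// nneseries_ge0.
    rewrite lee_fin; apply: (@le_trans _ _ (1 `^ gamma)); last by rewrite powR1.
    by apply: ge0_ler_powR; rewrite ?nnegrE// ltW.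
  apply: (@le_trans _ _ (f k w)).
    rewrite lee_fin indicE mem_set ?mulr1 -?p2.
      by apply: ge0_ler_powR; rewrite ?nnegrE// ltW.
    by rewrite /A /= ltNge; apply/negP => /kmin; rewrite ltnn.
  apply: (@le_trans _ _ (\sum_(k <oo) f k w)%E); last by rewrite leeDr.
  apply: (@le_trans _ _ (\sum_(0 <= i < k.+1) f i w)%E).
    by rewrite big_nat_recr//= leeDr// sume_ge0.
  exact: nneseries_lim_ge.
have c0 : 0 <= c.
  by have := le_trans (measure_ge0 _ _) (X_tail ltr01); rewrite divr1 lee_fin.
have sf n : (\sum_(0 <= k < n) \int[P]_w f k w <= (2 `^ gamma * c / (1 - q))%:E)%E.
  have fk k : (\int[P]_w f k w <= (2 `^ gamma * c * q ^+ k)%:E)%E.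
    under eq_integral do rewrite /f EFinM.
    rewrite ge0_integralZl_EFin ?exprn_ge0 ?powR_ge0//; last first.
      by apply/measurable_EFinP; exact: measurable_indic.
    rewrite integral_indic// setIT.
    have -> : 2 `^ gamma * c * q ^+ k = (2 `^ gamma) ^+ k.+1 * (c / 2 ^+ k).
      by rewrite /q expr_div_n exprS; field; rewrite expf_neq0.
    by rewrite EFinM lee_wpmul2l//; apply: X_tail; rewrite exprn_gt0.
  apply: (@le_trans _ _ (\sum_(0 <= k < n) (2 `^ gamma * c * q ^+ k)%:E)%E).
    by apply: lee_sum => k _; exact: fk.
  rewrite sumEFin lee_fin -mulr_sumr ler_wpM2l//.
    by rewrite mulr_ge0// powR_ge0.
  have q1' : 0 < 1 - q by rewrite subr_gt0.
  rewrite -[leRHS]mul1r ler_pdivlMr//.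
  have -> : (\sum_(0 <= i < n) q ^+ i) * (1 - q) = 1 - q ^+ n.
    elim: n => [|n IH]; first by rewrite big_geq// mul0r expr0 subrr.
    by rewrite big_nat_recr//= mulrDl IH exprS; ring.
  by rewrite lerBlDr lerDl exprn_ge0// ltW.
apply/integrableP; split.
  apply/measurable_EFinP; exact: (measurableT_comp (measurable_powR gamma) X_meas).
apply: (@le_lt_trans _ _ (\int[P]_w (1 + \sum_(k <oo) f k w))%E).
  apply: ge0_le_integral => //.
  - apply/measurable_EFinP; apply: measurableT_comp => //.
    exact: (measurableT_comp (measurable_powR gamma) X_meas).
  - apply: emeasurable_funD => //; exact: ge0_emeasurable_sum.
  - by move=> w _; rewrite /= ger0_norm ?powR_ge0.
rewrite ge0_integralD//; last 2 first.
- by move=> w _; exact: nneseries_ge0.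
- exact: ge0_emeasurable_sum.
rewrite integral_cst// [X in (_ * X)%E]probability_setT mule1 integral_nneseries//.
rewrite lte_add_pinfty ?ltry//.
apply: (@le_lt_trans _ _ (2 `^ gamma * c / (1 - q))%:E); last exact: ltry.
apply: lime_le; last exact: nearW.
by apply: is_cvg_nneseries => k _ _; exact: integral_ge0.
Qed.

End weak_moment.

Lemma counting_eq0 {T : choiceType} {R : realType} (A : set T) :
  counting A = 0%E :> \bar R -> A = set0.
Proof.
rewrite /counting; case: ifPn => // /asboolP finA [] /eqP.
by rewrite pnatr_eq0 finmap.cardfs_eq0 => /eqP /(fset_set_set0 finA).
Qed.

(** Enlarging [B] by the exceptional null set gives a true inclusion. This transfers probabilities
    between events on [Z] and on the [U i], which are linked only almost surely. *)
Lemma ae_le_measure d (T : measurableType d) (R : realType)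
    (m : {measure set T -> \bar R}) (A B : set T) :
  measurable A -> measurable B -> {ae m, forall x, A x -> B x} ->
  (m A <= m B)%E.
Proof.
move=> mA mB [N [mN mN0 subN]]; apply: (@le_trans _ _ (m (B `|` N))).
  apply: le_measure; rewrite ?inE//; first exact: measurableU.
  move=> x Ax; have [Bx|nBx] := pselect (B x); first by left.
  by right; apply: subN => /= AB; apply/nBx/AB.
by apply: le_trans (measureU2 _ mB mN) _; rewrite [X in (_ + X <= _)%E]mN0 adde0.
Qed.

(** * Law of the largest point of the Poisson process *)

Section poisson_maximum.
Context {R : realType} d (Omega : measurableType d) (P : probability Omega R).
Variables (U : nat -> Omega -> R) (mu : nat -> Omega -> S2 R).
Hypothesis ppp : poisson_point_process P intensity (fun i w => (U i w, mu i w)).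

Lemma exceedance_measurable t : measurable [set w | exists i, t < U i w].
Proof.
have [mxi _ _ _] := ppp.
rewrite (_ : [set w | _] = \bigcup_i (U i @^-1` `]t, +oo[)).
  apply: bigcup_measurable => i _; rewrite -[_ @^-1` _]setTI.
  have mU : measurable_fun setT (U i).
    exact: (measurableT_comp measurable_fst (mxi i)).
  exact: mU.
apply/seteqP; split => w.
  by move=> [i ti]; exists i => //=; rewrite in_itv/= ti.
by move=> [i _] /=; rewrite in_itv/= andbT => ti; exists i.
Qed.

(** The complementary event is that no point falls in the ray times the sphere, whose probability is
    the Poisson mass at 0. *)
Lemma exceedance_prob t : 0 < t ->
  P [set w | exists i, t < U i w] = (1 - expR (- (4 * pi / t)))%:E.
Proof.
move=> t0; have [_ pfin _ _] := ppp.
have r0 : 0 < 4 * pi / t by rewrite divr_gt0// mulr_gt0// pi_gt0.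
have mB : measurable (`]t, +oo[ `*` [set: S2 R]) by exact: measurableX.
have := pfin _ mB; rewrite intensity_ray// => /(_ isT 0%N).
rewrite /poisson_prob /= r0 esum_set1; last by rewrite lee_fin poisson_pmf_ge0.
rewrite /poisson_pmf r0 expr0 mul1r fact0 invr1 mul1r => P0.
rewrite -[X in P X]setCK probability_setC; last first.
  exact/measurableC/exceedance_measurable.
rewrite EFinB -P0; congr (1 - P _)%E.
apply/seteqP; split => w /=.
  move=> nU; rewrite /npoints (_ : [set i | _] = set0) ?measure0//.
  apply/seteqP; split => // i /= -[]; rewrite in_itv/= andbT => ti _.
  by apply: nU; exists i.
move=> /counting_eq0 nU [i ti]; suff : set0 i by [].
by rewrite -nU /= in_itv/= andbT.
Qed.

Lemma exceedance_prob_le t : 0 < t ->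
  (P [set w | (exists i, t < U i w)%R] <= (4 * pi / t)%:E)%E.
Proof.
move=> t0; rewrite exceedance_prob// lee_fin.
by have := expR_ge1Dx (- (4 * pi / t)); lra.
Qed.

End poisson_maximum.

(** * Lower and upper bounds on the process *)

Section vmf_process_bounds.
Context {R : realType} d (Omega : measurableType d) (P : probability Omega R).
Variables (kappa : R) (U : nat -> Omega -> R) (mu : nat -> Omega -> S2 R)
  (Z : {RV P >-> CS2 R}).
Hypothesis kappa_ge0 : 0 <= kappa.
Hypothesis Z_vmf : vmf_process P kappa U mu Z.

(** Phrased through exceedance events, whose probabilities are explicit; a single null set serves
    all [t]. *)
Lemma vmf_process_bounds : exists m M : R, [/\ 0 < m, 0 < M &
  {ae P, forall w t, 0 < t ->
    ((exists i, t < U i w) -> forall x, m * t <= Z w x) /\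
    (~ (exists i, t < U i w) -> forall x, Z w x <= M * t)}].
Proof.
have [m [M [m0 M0 fb]]] := vmf_bounds kappa_ge0.
have [U0 _ aeZ] := Z_vmf.
exists m, M; split => //; apply: filterS aeZ => w Zw t t0; split.
  move=> [i ti] x; rewrite -lee_fin Zw.
  apply: ereal_sup_ge; exists (U i w * vmf kappa (mu i w) x)%:E; first by exists i.
  have /andP[fm _] := fb (mu i w) x.
  by rewrite lee_fin mulrC ler_pM// ltW.
move=> nU x; rewrite -lee_fin Zw; apply: ge_ereal_sup => _ [i _ <-].
have /andP[fm fM] := fb (mu i w) x.
rewrite lee_fin [leRHS]mulrC ler_pM//.
- exact/ltW/U0.
- exact: le_trans (ltW m0) fm.
- by rewrite leNgt; apply/negP => ti; apply: nU; exists i.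
Qed.

Lemma vmf_process_minorized (s : R) : exists G : set Omega,
  [/\ measurable G, (0 < P G)%E & forall w, G w -> forall x, s <= Z w x].
Proof.
have [m [M [m0 M0 aeZ]]] := vmf_process_bounds.
have [_ ppp _] := Z_vmf.
(* A positive level is needed for the exceedance probability at [s' / m]. *)
pose s' := Num.max s 1.
have s'0 : 0 < s' by rewrite lt_max ltr01 orbT.
have t0 : 0 < s' / m by rewrite divr_gt0.
(* Defining the event by [Z] itself makes the bound hold at each of its points, not just almost
   surely. *)
exists (Z @^-1` [set z | forall x, s' <= z x]); split.
- rewrite -[_ @^-1` _]setTI; apply: measurable_funP => //.
  exact: CS2_ge_measurable.
- apply: (@lt_le_trans _ _ (P [set w | exists i, s' / m < U i w])).
    rewrite (exceedance_prob ppp)// lte_fin subr_gt0 -expR0 ltr_expR oppr_lt0.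
    by rewrite divr_gt0// mulr_gt0// pi_gt0.
  apply: ae_le_measure; first exact: (exceedance_measurable ppp).
    rewrite -[_ @^-1` _]setTI; apply: measurable_funP => //.
    exact: CS2_ge_measurable.
  apply: filterS aeZ => w /(_ _ t0)[Zw _] /Zw {}Zw x.
  by apply: le_trans (Zw x); rewrite mulrC divfK// gt_eqF.
- by move=> w Zs x; apply: le_trans (Zs x); rewrite /s' le_max lexx.
Qed.

(** Almost surely, a supremum above [t] forces some [U i] above [t / M], so the tail is at most
    [M * (4 * pi) / t]. *)
Lemma vmf_process_moment (gamma : R) : 0 < gamma -> gamma < 1 ->
  P.-integrable setT (EFin \o (fun w => supnorm (Z w) `^ gamma)).
Proof.
move=> g0 g1; have [m [M [m0 M0 aeZ]]] := vmf_process_bounds.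
have [_ ppp _] := Z_vmf.
have mZ : measurable_fun setT (fun w => supnorm (Z w)).
  exact: (measurableT_comp supnorm_measurable (measurable_funPT Z)).
apply: (@weak_moment_integrable _ _ _ _ _ (M * (4 * pi))) => //.
- by move=> w; exact: CS2_supnorm_ge0.
move=> t t0; have tM0 : 0 < t / M by rewrite divr_gt0.
apply: (@le_trans _ _ (P [set w | exists i, t / M < U i w])); last first.
  apply: le_trans (exceedance_prob_le ppp tM0) _.
  by rewrite lee_fin invf_div mulrCA mulrA.
apply: ae_le_measure; last 1 first.
- apply: filterS aeZ => w /(_ _ tM0)[_ Zw] tZ; apply: contrapT => /Zw {}Zw.
  move: tZ; apply/negP; rewrite -leNgt; apply: CS2_supnorm_le => x.
  by apply: le_trans (Zw x) _; rewrite mulrC divfK// gt_eqF.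
- rewrite (_ : [set w | _] = (fun w => supnorm (Z w)) @^-1` `]t, +oo[%classic).
    by rewrite -[_ @^-1` _]setTI; exact: mZ.
  by apply/seteqP; split => w; rewrite /= in_itv/= andbT.
- exact: (exceedance_measurable ppp).
Qed.

End vmf_process_bounds.

(** * Geometric ergodicity of the max-autoregressive chain *)

Section weighted_norm.
Context {R : realType} d (X : measurableType d) (L : X -> R).
Hypothesis L_ge0 : forall h, 0 <= L h.

(** Passage between the extended-real norm and the pointwise real bounds of the ergodicity
    argument. *)
Lemma wsupnormP (phi : X -> R) (N : R) :
  (wsupnorm L phi <= N%:E)%E <-> forall h, `|phi h| <= N * (1 + L h).
Proof.
have L1 h : 0 < 1 + L h by rewrite ltr_pwDl.
split => [supN h|phiN].
  rewrite -ler_pdivrMr// -lee_fin; apply: le_trans supN.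
  by apply: ereal_sup_ubound; exists h.
by apply: ge_ereal_sup => _ [h _ <-]; rewrite lee_fin ler_pdivrMr.
Qed.

Lemma wsupnorm_ge0 (phi : X -> R) : (0 <= wsupnorm L phi)%E.
Proof.
apply: (@le_trans _ _ (`|phi point| / (1 + L point))%:E).
  by rewrite lee_fin divr_ge0// addr_ge0.
by apply: ereal_sup_ubound; exists point.
Qed.

End weighted_norm.

Theorem theorem3 (R : realType) (d : measure_display)
    (Omega : measurableType d) (P : probability Omega R)
    (a theta kappa gamma : R) (u : S2 R)
    (U : nat -> Omega -> R) (mu : nat -> Omega -> S2 R)
    (Z : {RV P >-> CS2 R}) (pi_star : probability (CS2 R) R)
    (a_gt0 : 0 < a) (a_lt1 : a < 1) (kappa_ge0 : 0 <= kappa)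
    (gamma_gt0 : 0 < gamma) (gamma_lt1 : gamma < 1)
    (Z_vmf : vmf_process P kappa U mu Z)
    (pi_star_inv : unique_invariant_measure (trans_kernel a theta u Z) pi_star) :
  let L := fun h : CS2 R => supnorm (fun x => h x `^ gamma) in
  exists C rho : R, [/\ 0 < C, 0 < rho < 1 &
    forall (n : nat) (phi : CS2 R -> R), (0 < n)%N ->
      measurable_fun [set: CS2 R] phi ->
      (wsupnorm L phi < +oo)%E ->
      let pi_phi := \int[pi_star]_h phi h in
      (wsupnorm L (fun h =>
         (kernel_op (nstep (trans_kernel a theta u Z) n) phi h - pi_phi)%R)
       <= (C * rho ^+ n)%:E * wsupnorm L (fun h => (phi h - pi_phi)%R))%E].
Proof.
move=> L.
have L_ge0 h : 0 <= L h by rewrite /L supnorm_powR// powR_ge0.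
have a1_ge0 : 0 <= 1 - a by rewrite subr_ge0 ltW.
pose F h : {RV P >-> CS2 R} := max_step a theta u h \o Z.
pose ell w := (1 - a) `^ gamma * supnorm (Z w) `^ gamma.
have ell_ge0 w : 0 <= ell w by rewrite mulr_ge0// powR_ge0.
have ell_int : P.-integrable setT (EFin \o ell).
  rewrite (_ : _ \o _ = (fun w => ((1 - a) `^ gamma)%:E *
      (EFin \o (fun w => supnorm (Z w) `^ gamma)%R) w)%E).
    apply: integrableZl => //.
    exact: vmf_process_moment kappa_ge0 Z_vmf _ gamma_gt0 gamma_lt1.
  by apply/funext => w; rewrite /= EFinM.
have b_lt1 : a `^ gamma < 1.
  have : a `^ gamma < 1 `^ gamma by apply: gt0_ltr_powR; rewrite ?nnegrE// ltW.
  by rewrite powR1.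
have drift h w : L (F h w) <= a `^ gamma * L h + ell w.
  rewrite /ell -supnorm_powR//.
  by apply: supnorm_powR_max_step => //; exact: ltW.
have coalescence (r : R) : exists G : set Omega,
    [/\ measurable G, (0 < P G)%E &
      forall w h h', G w -> L h <= r -> L h' <= r -> F h w = F h' w].
  (* This level is the least [s] with [a * supnorm h <= (1 - a) * s] when [supnorm h] is the power
     [gamma^-1] of [r]; the maximum with 0 keeps the base nonnegative. *)
  have [G [mG PG ZG]] := vmf_process_minorized kappa_ge0 Z_vmf
    (a * (Num.max r 0) `^ gamma^-1 / (1 - a)).
  have hr h : L h <= r -> a * supnorm h <=
      (1 - a) * (a * (Num.max r 0) `^ gamma^-1 / (1 - a)).
    move=> Lr; rewrite [leRHS]mulrC divfK ?gt_eqF ?subr_gt0// ler_wpM2l ?(ltW a_gt0)//.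
    have -> : supnorm h = L h `^ gamma^-1.
      rewrite /L supnorm_powR// -powRrM mulfV ?gt_eqF// powRr1//.
      exact: CS2_supnorm_ge0.
    apply: ge0_ler_powR; rewrite ?nnegrE ?invr_ge0 ?(ltW gamma_gt0)//.
      by rewrite le_max lexx orbT.
    by rewrite le_max Lr.
  exists G; split => // w h h' Gw /hr hs /hr h's.
  by apply: max_step_coalescence (ZG w Gw) hs h's; exact: ltW.
have [pi_inv _] := pi_star_inv.
have [C [rho [C0 /andP[rho0 rho1] erg]]] :=
  @geometric_ergodicity _ _ _ _ _ P (trans_kernel a theta u Z) F L ell _
    (fun _ _ _ => erefl) (supnorm_powR_measurable gamma_gt0) L_ge0 ell_ge0
    ell_int (powR_ge0 _ _) b_lt1 drift coalescence pi_star pi_inv.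
exists C, rho; split => [//||]; first by rewrite rho0.
move=> n phi _ mphi phi_fin; lazy zeta; set pi_phi := \int[pi_star]_h phi h.
have Crho0 : 0 < C * rho ^+ n by rewrite mulr_gt0// exprn_gt0.
have fin_bound (psi : CS2 R -> R) : (wsupnorm L psi < +oo)%E ->
    forall h, `|psi h| <= fine (wsupnorm L psi) * (1 + L h).
  move=> psi_fin; apply/(wsupnormP L_ge0); rewrite fineK//.
  by rewrite ge0_fin_numE ?wsupnorm_ge0.
(* An infinite norm on the right makes the inequality trivial, since its factor is positive. *)
have [Wy|Wfin] := eqVneq (wsupnorm L (fun h => phi h - pi_phi)) +oo%E.
  by rewrite Wy gt0_muley ?lte_fin// leey.
rewrite -ltey in Wfin.
rewrite -(fineK (x := wsupnorm L (fun h => phi h - pi_phi))); last first.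
  by rewrite ge0_fin_numE ?wsupnorm_ge0.
rewrite -EFinM; apply/(wsupnormP L_ge0).
exact: erg n _ _ _ (conj mphi (fin_bound _ phi_fin)) (fin_bound _ Wfin).
Qed.
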